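(* The decision problem Cops and Robber for (general) edge periodic graphs is contained in PSPACE.
   Context: An edge periodic graph $\mathcal{G}=(V,E,\tau)$ consists of a finite graph $G=(V,E)$ (the underlying graph) and a function $\tau: E\to\{0,1\}^*$ such that edge $e$ exists in time step $t\ge 0$ if and only if $\tau(e)[t \bmod |\tau(e)|]=1$; every edge exists in at least one time step. The one-cop game: first the cop chooses a start vertex, then the robber chooses a start vertex. Then in each time step $t=0,1,2,\dots$, first the cop and then the robber either stays on its current vertex or moves to an adjacent vertex along an edge present at time step $t$. The cop catches the robber if at some time step, after the cop has moved, cop and robber are on the same vertex. $\mathcal{G}$ is cop-winning if the cop has a strategy (including a choice of start vertex) that catches the robber regardless of the robber's start vertex and moves. The problem Cops and Robber: given an edge periodic graph $\mathcal{G}=(V,E,\tau)$ (with each $\tau(e)$ given explicitly as a binary string), decide whether $\mathcal{G}$ is cop-winning. *)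

(* Defs.v *)
From mathcomp Require Import all_boot all_order all_algebra.

Set Implicit Arguments.
Unset Strict Implicit.
Unset Printing Implicit Defensive.

Inductive direction := Left | Stay | Right.

Section Turing.

Variable Sigma : finType.

(* Deterministic Turing machines with [tm_tapes.+1] tapes.  The tape alphabet is
   [option (Sigma + tm_work)]: [None] is the blank, [Some (inl a)] an input
   symbol, [Some (inr b)] an auxiliary work symbol.  Tape [ord0] carries the
   input. *)
Record tm := TM {
  tm_tapes : nat;
  tm_work : finType;
  tm_state : finType;
  tm_start : tm_state;
  tm_accept : tm_state;
  tm_reject : tm_state;
  tm_accept_reject : tm_accept != tm_reject;
  tm_trans : tm_state -> {ffun 'I_tm_tapes.+1 -> option (Sigma + tm_work)} ->
             tm_state *
             ('I_tm_tapes.+1 -> option (Sigma + tm_work) * direction)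
}.

Variable M : tm.

Definition tm_sym : Type := option (Sigma + tm_work M).

(* Tapes are infinite to the right only: their cells are numbered by [nat]. *)
Record tm_config := TMConfig {
  cfg_state : tm_state M;
  cfg_head : 'I_(tm_tapes M).+1 -> nat;
  cfg_tape : 'I_(tm_tapes M).+1 -> nat -> tm_sym
}.

(* A head that tries to move left from cell 0 does not move. *)
Definition move_head (d : direction) (p : nat) : nat :=
  match d with Left => p.-1 | Stay => p | Right => p.+1 end.

Definition tm_step (c : tm_config) : tm_config :=
  if (cfg_state c == tm_accept M) || (cfg_state c == tm_reject M) then c
  else
    let a := tm_trans (cfg_state c) [ffun i => cfg_tape c i (cfg_head c i)] in
    TMConfig a.1
      (fun i => move_head (a.2 i).2 (cfg_head c i))
      (fun i p => if p == cfg_head c i then (a.2 i).1 else cfg_tape c i p).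

Definition tm_init (w : seq Sigma) : tm_config :=
  TMConfig (tm_start M) (fun=> 0)
    (fun i p => if i == ord0 then nth None [seq Some (inl a) | a <- w] p
                else None).

Definition tm_run (w : seq Sigma) (t : nat) : tm_config :=
  iter t tm_step (tm_init w).

Definition tm_decides (L : seq Sigma -> Prop) : Prop :=
  forall w,
    (L w -> exists t, cfg_state (tm_run w t) = tm_accept M) /\
    (~ L w -> exists t, cfg_state (tm_run w t) = tm_reject M).

(* On every tape (the input tape included), only the first [s n] cells are
   ever visited on inputs of length [n]. *)
Definition tm_space (s : nat -> nat) : Prop :=
  forall w t i, cfg_head (tm_run w t) i < s (size w).

End Turing.

Definition PSPACE (Sigma : finType) (L : seq Sigma -> Prop) : Prop :=
  exists (M : tm Sigma) (p : {poly nat}),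
    tm_decides M L /\ tm_space M (fun n => p.[n])%R.

(* The values of [ep_tau] outside [ep_edges] are irrelevant. *)
Record epgraph (V : finType) := EPGraph {
  ep_edges : {set {set V}};
  ep_tau : {set V} -> seq bool;
  ep_edges2 : forall e, e \in ep_edges -> #|e| = 2;
  ep_tau1 : forall e, e \in ep_edges -> true \in ep_tau e
}.

Section Game.

Variables (V : finType) (G : epgraph V).

Definition present (t : nat) (e : {set V}) : bool :=
  (e \in ep_edges G) && nth false (ep_tau G e) (t %% size (ep_tau G e)).

Definition legal_move (t : nat) (u v : V) : bool :=
  (u == v) || present t [set u; v].

(* [r 0] is the start vertex of the robber, [r t.+1] its vertex after its move
   in time step [t]. *)
Definition robber_play (r : nat -> V) : Prop :=
  forall t, legal_move t (r t) (r t.+1).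

(* A strategy of the cop consists of a start vertex [c0] and a function [s]:
   in time step [t] the cop goes to [s [:: r 0; ...; r t]].  The earlier
   positions of the cop are themselves determined by [c0], [s] and that list.
   [cop_pos c0 s r t.+1] is the vertex of the cop after its move in step [t]. *)
Definition cop_pos (c0 : V) (s : seq V -> V) (r : nat -> V) (t : nat) : V :=
  if t is _.+1 then s (mkseq r t) else c0.

(* Asking for legal moves also after the catch is harmless, since the cop may
   then stay where it is. *)
Definition cop_winning : Prop :=
  exists (c0 : V) (s : seq V -> V), forall r, robber_play r ->
    (forall t, legal_move t (cop_pos c0 s r t) (cop_pos c0 s r t.+1)) /\
    (exists t, cop_pos c0 s r t.+1 = r t).

End Game.

Section Encoding.

(* Input alphabet: [Some b] is the bit [b], [None] a separator. *)
Definition letter : finType := option bool.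

Variables (n : nat) (G : epgraph 'I_n).

(* The empty string stands for a non-edge; labels of edges are nonempty. *)
Definition entry (i j : 'I_n) : seq bool :=
  if [set i; j] \in ep_edges G then ep_tau G [set i; j] else [::].

Definition pairs : seq ('I_n * 'I_n) :=
  [seq p : 'I_n * 'I_n <- [seq (i, j) | i <- enum 'I_n, j <- enum 'I_n] |
    p.2 < p.1].

(* The number of vertices in unary, followed by the strictly lower triangular
   part of the adjacency matrix, row by row, with the labels as entries. *)
Definition encode : seq letter :=
  rcons (nseq n (Some true)) None ++
  flatten [seq rcons (map Some x) None | x <- [seq entry p.1 p.2 | p <- pairs]].

End Encoding.

Definition cops_and_robber (w : seq letter) : Prop :=
  exists (n : nat) (G : epgraph 'I_n), w = encode G /\ cop_winning G.

Lemma encode_card n m (G : epgraph 'I_n) (H : epgraph 'I_m) :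
  encode G = encode H -> n = m.
Proof.
rewrite /encode !cat_rcons; set s := flatten _; set t := flatten _.
by elim: n m {G H} s t => [|n IH] [|m] //= s t [] /IH ->.
Qed.

Lemma terminated_inj (s t : seq (seq bool)) :
  flatten [seq rcons (map Some x) None | x <- s] =
  flatten [seq rcons (map Some x) None | x <- t] -> s = t.
Proof.
elim: s t => [|x s IH] [|y t] //=; try by case: (map Some _).
rewrite !cat_rcons.
suff E (u v : seq letter) :
    map Some x ++ None :: u = map Some y ++ None :: v -> x = y /\ u = v.
  by case/E=> -> /IH ->.
elim: x y => [|a x IHx] [|b y] //=; first by case.
by case=> -> /IHx [-> ->].
Qed.

Lemma encode_inj n (G H : epgraph 'I_n) : encode G = encode H ->
  ep_edges G = ep_edges H /\ {in ep_edges G, ep_tau G =1 ep_tau H}.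
Proof.
move/(congr1 (drop n.+1)).
rewrite /encode !drop_size_cat ?size_rcons ?size_nseq //.
move/terminated_inj/eq_in_map => eqE.
have entE (i j : 'I_n) : i != j -> entry G i j = entry H i j.
  wlog ji : i j / j < i => [wl|_].
    case: (ltngtP j i) => [||/val_inj ->]; last by rewrite eqxx.
      exact: wl.
    by rewrite eq_sym /entry (setUC [set i]); apply: wl.
  apply: (eqE (i, j)); rewrite mem_filter ji /=.
  by apply/allpairsP; exists (i, j); rewrite !mem_enum.
have inE (K : epgraph 'I_n) (i j : 'I_n) :
    ([set i; j] \in ep_edges K) = (entry K i j != [::]).
  rewrite /entry; case: ifP => // /ep_tau1; by case: (ep_tau K _).
have eqG : ep_edges G = ep_edges H.
  apply/setP => e; apply/idP/idP => he; have /eqP/cards2P[i [j [ij E]]] := ep_edges2 he.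
    by rewrite E inE -entE // -inE -E.
  by rewrite E inE entE // -inE -E.
split=> // e he; have /eqP/cards2P[i [j [ij E]]] := ep_edges2 he.
by have := entE i j ij; rewrite /entry -E -eqG he.
Qed.

(* Main.v *)
From mathcomp Require Import all_boot all_order all_algebra zify.
From Stdlib Require Import FunctionalExtensionality.
Require Import Defs.

Set Implicit Arguments.
Unset Strict Implicit.
Unset Printing Implicit Defensive.

Local Open Scope nat_scope.

(* Fix a horizon T.  For every time t, the set of positions (cop, robber) from
   which the cop, to move at time t, catches the robber before time T has at
   most n^2 elements, so it can be stored even if the game lasts exponentially
   long.  It is computed backwards, from t = T down to t = 0, with t kept in
   binary.  T = 2^(3|w|) is large enough: if L is a common multiple of the label
   lengths, the winning region is a least fixed point on the n^2 L <= T positions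
   with time modulo L.

   To obtain a Turing machine, one step of this computation is written in a
   language of arithmetic expressions in which recursion is cut off at a given
   bound, so that all values are polynomial in the input size.  A number is
   represented by the position of a tape head. *)

(** * Structured tape programs *)

(** No register can hold the time, which is exponential in |w|. A move depends on it only through
    its residue modulo one label length, and [xMod] obtains that residue from the stored bits by
    Horner's scheme. The three factors 2^|w| of the horizon bound the two positions and a common
    period: the number of vertices is at most |w|, and the lengths of the nonempty labels have
    product at most 2^|w|, because k <= 2^k and the labels occupy disjoint parts of w. That a finite
    horizon suffices against strategies that remember the whole play is a fixed-point argument: the
    region reached after n^2 L backward steps is stable, so a robber outside it can stay outside
    forever. The clock shows the time step to be computed next, one less than the time of the stored
    region. It starts at T - 1 with the empty region, and the step at time 0 is left to the final
    test [xResult]. *)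

Section Programs.

Variable Sigma : finType.

Definition symbol : eqType := option (Sigma + unit).

(* [Until i s p] repeats [p] until the head of tape [i] reads [s]. *)
Inductive prog :=
| Skip
| Move (i : nat) (d : direction)
| Put (i : nat) (s : symbol)
| Seq (p q : prog)
| If (i : nat) (s : symbol) (p q : prog)
| Until (i : nat) (s : symbol) (p : prog).

Record conf := Conf { heads : nat -> nat; tapes : nat -> nat -> symbol }.

Definition scan (c : conf) (i : nat) : symbol := tapes c i (heads c i).

Definition upd (T : Type) (f : nat -> T) (i : nat) (x : T) : nat -> T :=
  fun j => if j == i then x else f j.

Definition moved (i : nat) (d : direction) (c : conf) : conf :=
  Conf (upd (heads c) i (move_head d (heads c i))) (tapes c).

Definition written (i : nat) (s : symbol) (c : conf) : conf :=
  Conf (heads c) (upd (tapes c) i (upd (tapes c i) (heads c i) s)).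

Inductive until_exec (i : nat) (s : symbol) (R : conf -> conf -> Prop) :
  conf -> conf -> Prop :=
| UntilStop c : scan c i = s -> until_exec i s R c c
| UntilStep c c1 c2 : scan c i != s -> R c c1 -> until_exec i s R c1 c2 ->
    until_exec i s R c c2.

(* [exec B p c c'] : [p] leads from [c] to [c'] without moving a head beyond
   cell [B]. *)
Fixpoint exec (B : nat) (p : prog) (c c' : conf) : Prop :=
  match p with
  | Skip => c' = c
  | Move i d => c' = moved i d c /\ heads c' i <= B
  | Put i s => c' = written i s c
  | Seq p q => exists2 c1, exec B p c c1 & exec B q c1 c'
  | If i s p q => if scan c i == s then exec B p c c' else exec B q c c'
  | Until i s p => until_exec i s (exec B p) c c'
  end.

Definition within (B : nat) (c : conf) := forall i, heads c i <= B.

Lemma exec_within B p c c' : exec B p c c' -> within B c -> within B c'.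
Proof.
elim: p c c' => [|i d|i s|p IHp q IHq|i s p IHp q IHq|i s p IHp] c c' /=.
- by move->.
- by case=> -> /= le_B cB j; move: le_B; rewrite /= /upd eqxx; case: eqP.
- by move->.
- by case=> c1 /IHp H1 /IHq H2 /H1/H2.
- by case: ifP => _; [apply: IHp|apply: IHq].
- by elim=> // {}c c1 c2 _ /IHp H1 _ H2 /H1/H2.
Qed.

(** * Programs as finite automata *)

Fixpoint pstate (p : prog) : finType :=
  match p with
  | Skip | Move _ _ | Put _ _ => unit
  | Seq p q => (pstate p + pstate q)%type
  | If _ _ p q => option (pstate p + pstate q)%type
  | Until _ _ p => option (pstate p)
  end.

(** [None] is the state in which the test of a conditional or a loop is made; a loop returns to it
    after each round. *)
Fixpoint pstart (p : prog) : pstate p :=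
  match p with
  | Skip | Move _ _ | Put _ _ => tt
  | Seq p q => inl (pstart p)
  | If _ _ p q => None
  | Until _ _ p => None
  end.

Definition action := option (nat * (symbol + direction)).

Definition act (a : action) (c : conf) : conf :=
  match a with
  | None => c
  | Some (i, inl s) => written i s c
  | Some (i, inr d) => moved i d c
  end.

(* The successor state is [None] on exit from the program. *)
Fixpoint ptrans (p : prog) (r : nat -> symbol) :
    pstate p -> option (pstate p) * action :=
  match p with
  | Skip => fun=> (None, None)
  | Move i d => fun=> (None, Some (i, inr d))
  | Put i s => fun=> (None, Some (i, inl s))
  | Seq p q => fun x =>
      match x with
      | inl y => let: (z, a) := ptrans r y in
                 (Some (if z is Some z' then inl z' else inr (pstart q)), a)
      | inr y => let: (z, a) := ptrans r y in (omap inr z, a)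
      end
  | If i s p q => fun x =>
      match x with
      | None =>
          (Some (Some (if r i == s then inl (pstart p) else inr (pstart q))),
           None)
      | Some (inl y) => let: (z, a) := ptrans r y in
                        (omap (fun z' => Some (inl z')) z, a)
      | Some (inr y) => let: (z, a) := ptrans r y in
                        (omap (fun z' => Some (inr z')) z, a)
      end
  | Until i s p => fun x =>
      match x with
      | None => (if r i == s then None else Some (Some (pstart p)), None)
      | Some y => let: (z, a) := ptrans r y in (Some z, a)
      end
  end.

(** The bound is imposed along the whole run, since the space bound of a machine concerns all times.
    Only the initial configuration is left out. *)
Inductive leads (p : prog) (B : nat) : pstate p -> conf -> conf -> Prop :=
| LeadsExit x c a : ptrans (scan c) x = (None, a) -> within B (act a c) ->
    leads B x c (act a c)
| LeadsStep x y c c' a : ptrans (scan c) x = (Some y, a) ->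
    within B (act a c) -> leads B y (act a c) c' -> leads B x c c'.

(** A run of a component becomes a run of the compound program by relabelling its states; its exit
    turns into a step to the next component or back to the test of the loop. *)
Lemma exec_leads B p c c' : exec B p c c' -> within B c ->
  leads B (pstart p) c c'.
Proof.
elim: p c c' => [|i d|i s|p IHp q IHq|i s p IHp q IHq|i s p IHp] c c' ex cB.
- by rewrite /= in ex; rewrite ex; apply: (@LeadsExit Skip _ _ _ None).
- have wB := exec_within ex cB.
  case: ex => -> _ in wB *.
  exact: (@LeadsExit (Move i d) _ _ _ (Some (i, inr d))).
- have wB := exec_within ex cB.
  rewrite /= in ex; rewrite ex in wB *.
  exact: (@LeadsExit (Put i s) _ _ _ (Some (i, inl s))).
- case: ex => c1 e1 e2.
  have l2 := IHq _ _ e2 (exec_within e1 cB).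
  have {}l2 : @leads (Seq p q) B (inr (pstart q)) c1 c'.
    elim: l2 => [x c3 a E w|x y c3 c4 a E w _ IH].
      by apply: LeadsExit => //=; rewrite E.
    by apply: LeadsStep w IH; rewrite /= E.
  have := IHp _ _ e1 cB; rewrite [pstart (Seq p q)]/=.
  move: (pstart p) => x l1; elim: l1 l2 => {x} [x c3 a E w|x y c3 c4 a E w _ IH] l2.
    by apply: LeadsStep w l2; rewrite /= E.
  by apply: LeadsStep w (IH l2); rewrite /= E.
- move: ex; rewrite [exec _ _ _ _]/=; case: ifP => Es ex.
    apply: (@LeadsStep (If i s p q) _ None (Some (inl (pstart p))) _ _ None) => //=.
      by rewrite Es.
    elim: (IHp _ _ ex cB) => [x c3 a E w|x y c3 c4 a E w _ IH].
      by apply: LeadsExit => //=; rewrite E.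
    by apply: LeadsStep w IH; rewrite /= E.
  apply: (@LeadsStep (If i s p q) _ None (Some (inr (pstart q))) _ _ None) => //=.
    by rewrite Es.
  elim: (IHq _ _ ex cB) => [x c3 a E w|x y c3 c4 a E w _ IH].
    by apply: LeadsExit => //=; rewrite E.
  by apply: LeadsStep w IH; rewrite /= E.
- move: ex cB; rewrite [exec _ _ _ _]/= => ex.
  elim: ex => [{}c Es|{}c c1 c2 Es ex _ IH] cB.
    apply: (@LeadsExit (Until i s p) _ None _ None) => //=.
    by rewrite Es eqxx.
  apply: (@LeadsStep (Until i s p) _ None (Some (pstart p)) _ _ None) => //=.
    by rewrite (negPf Es).
  have {}IH := IH (exec_within ex cB).
  have l1 := IHp _ _ ex cB.
  move: (pstart p) l1 => x l1; elim: l1 IH => {x} [x c3 a E w|x y c3 c4 a E w _ IH] l2.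
    by apply: LeadsStep w l2; rewrite /= E.
  by apply: LeadsStep w (IH l2); rewrite /= E.
Qed.

Fixpoint max_tape (p : prog) : nat :=
  match p with
  | Skip => 0
  | Move i _ => i
  | Put i _ => i
  | Seq p q => maxn (max_tape p) (max_tape q)
  | If i _ p q => maxn i (maxn (max_tape p) (max_tape q))
  | Until i _ p => maxn i (max_tape p)
  end.

(** Programs address tapes by arbitrary numbers, while the machine has finitely many: only those up
    to [max_tape p] are consulted. *)
Lemma ptrans_ext p r r' (x : pstate p) :
  (forall i, i <= max_tape p -> r i = r' i) -> ptrans r x = ptrans r' x.
Proof.
elim: p x => [|i d|i s|p IHp q IHq|i s p IHp q IHq|i s p IHp] //= x H.
- case: x => y; [rewrite IHp // | rewrite IHq //] => j lej; apply: H;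
  by rewrite leq_max lej ?orbT.
- case: x => [[y|y]|].
  + by rewrite IHp // => j lej; apply: H; rewrite !leq_max lej ?orbT.
  + by rewrite IHq // => j lej; apply: H; rewrite !leq_max lej ?orbT.
  + by rewrite H // leq_max leqnn.
- case: x => [y|].
  + by rewrite IHp // => j lej; apply: H; rewrite !leq_max lej ?orbT.
  + by rewrite H // leq_max leqnn.
Qed.

(** * From a program to a Turing machine *)

Variables (k : nat) (p : prog) (out : nat) (zero : symbol).

(* The machine runs [p], then rejects iff the head of tape [out] reads
   [zero]. *)
Definition machine_state : finType := (pstate p + option bool)%type.

(** [inr None] makes the final test; [inr (Some b)] are the accepting and the rejecting state, in
    which [tm_step] halts. *)
Definition machine_trans (x : machine_state)
    (f : {ffun 'I_k.+1 -> symbol}) :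
    machine_state * ('I_k.+1 -> symbol * direction) :=
  match x with
  | inl y =>
      let: (z, a) := ptrans (fun i => f (inord i)) y in
      (if z is Some z' then inl z' else inr None,
       fun i : 'I_k.+1 => match a with
                | Some (j, inl s) => (if nat_of_ord i == j then s else f i, Stay)
                | Some (j, inr d) => (f i, if nat_of_ord i == j then d else Stay)
                | None => (f i, Stay)
                end)
  | inr _ => (inr (Some (f (inord out) != zero)), fun i => (f i, Stay))
  end.

Definition machine : tm Sigma :=
  @TM Sigma k unit machine_state (inl (pstart p)) (inr (Some true))
    (inr (Some false)) isT machine_trans.

Definition machine_conf (x : machine_state) (c : conf) : tm_config machine :=
  @TMConfig Sigma machine x (fun i => heads c i) (fun i => tapes c i).

Hypotheses (le_pk : max_tape p <= k) (le_outk : out <= k).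

Lemma machine_stepE x c : tm_step (machine_conf (inl x) c) =
  let: (z, a) := ptrans (scan c) x in
  machine_conf (if z is Some z' then inl z' else inr None) (act a c).
Proof.
rewrite /tm_step /=.
rewrite (@ptrans_ext _ _ (scan c)); last first.
  by move=> i le_i; rewrite ffunE /= inordK // ltnS (leq_trans le_i).
case: (ptrans (scan c) x) => z a.
case: a => [[j [s|d]]|] /=; congr TMConfig.
- apply: functional_extensionality => i; apply: functional_extensionality => q.
  rewrite ffunE /= /upd /scan; case: (nat_of_ord i =P j) => [->|_] //.
  by case: eqP => // ->.
- apply: functional_extensionality => i; rewrite /= /upd.
  by case: (nat_of_ord i =P j) => [->|].
- apply: functional_extensionality => i; apply: functional_extensionality => q.
  by rewrite ffunE /=; case: eqP => // ->.
- apply: functional_extensionality => i; apply: functional_extensionality => q.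
  by rewrite ffunE /=; case: eqP => // ->.
Qed.

(** [u = 0] is a separate case because [leads] says nothing about the heads of [c]. *)
Lemma leads_machine B x c c' : leads B x c c' ->
  exists t, iter t (@tm_step _ machine) (machine_conf (inl x) c) =
      machine_conf (inr None) c' /\
    forall u i, u <= t ->
      u = 0 \/ cfg_head (iter u (@tm_step _ machine) (machine_conf (inl x) c)) i <= B.
Proof.
elim=> {x c c'} [x c a E w|x y c c' a E w _ [t [IH1 IH2]]].
  exists 1; rewrite /= machine_stepE E; split=> // -[|[|u]] i // _; first by left.
  by right; rewrite iterSr machine_stepE E; apply: w.
exists t.+1; rewrite iterSr machine_stepE E; split=> // -[|u] i ut; first by left.
right; rewrite iterSr machine_stepE E.
by case: (IH2 u i ut) => // ->; apply: w.
Qed.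

Lemma machine_run B c c' : exec B p c c' -> within B c ->
  (exists t, cfg_state (iter t (@tm_step _ machine)
     (machine_conf (inl (pstart p)) c)) = inr (Some (scan c' out != zero))) /\
  forall u i, cfg_head (iter u (@tm_step _ machine)
     (machine_conf (inl (pstart p)) c)) i <= B.
Proof.
move=> ex cB; have c'B := exec_within ex cB.
have [t [E1 E2]] := leads_machine (exec_leads ex cB).
set c0 := machine_conf _ c in E1 E2 *.
pose b := scan c' out != zero.
have Ef : tm_step (machine_conf (inr None) c') = machine_conf (inr (Some b)) c'.
  rewrite /tm_step /machine_conf /=; congr TMConfig.
    by rewrite /b ffunE /= inordK.
  apply: functional_extensionality => i; apply: functional_extensionality => q.
  by rewrite ffunE /=; case: eqP => // ->.
(* The halting configuration is fixed, so the head bound extends to all later times. *)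
have Eh u : iter u (@tm_step _ machine) (machine_conf (inr (Some b)) c') =
            machine_conf (inr (Some b)) c'.
  by elim: u => //= u ->; rewrite /tm_step /=; case: (b).
split; first by exists t.+1; rewrite /= E1 Ef.
move=> u i; case: (leqP u t) => [ut|tu].
  by case: (E2 u i ut) => // ->; apply: cB.
have -> : u = (u - t.+1) + t.+1 by rewrite subnK.
by rewrite iterD [iter t.+1 _ _]iterS E1 Ef Eh; apply: c'B.
Qed.

End Programs.

Arguments exec : simpl never.

Ltac heads_eq := rewrite /upd /=; repeat (case: eqP); intros; subst; lia.

(** * Arithmetic expressions on head positions *)

Section Expressions.

Variable Sigma : finType.
Local Notation symbol := (symbol Sigma).
Local Notation prog := (prog Sigma).

Definition mark : symbol := Some (inr tt).

(* Variables are de Bruijn indices into the environment; [Weak k e] evaluates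
   [e] after dropping the [k] innermost entries.  [Read i s e] tests whether
   cell [e] of tape [i] holds [s].  [Rec n b e f] is a recursion of length [n]
   from [e] whose values are cut off at [b]: this keeps all values polynomial
   in the size of the input. *)
Inductive expr :=
| Var (i : nat)
| Size
| Cst (k : nat)
| Add (a b : expr)
| Weak (k : nat) (a : expr)
| Let (a b : expr)
| Cond (a b c : expr)
| Read (i : 'I_3) (s : symbol) (a : expr)
| Sum (n f : expr)
| Rec (n b e f : expr).

Section Eval.

Variables (sz : nat) (A : nat -> nat -> symbol).

Fixpoint eval (e : expr) (env : seq nat) : nat :=
  match e with
  | Var i => nth 0 env i
  | Size => sz
  | Cst k => k
  | Add a b => eval a env + eval b env
  | Weak k a => eval a (drop k env)
  | Let a b => eval b (eval a env :: env)
  | Cond a b c => if eval a env == 0 then eval c env else eval b env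
  | Read i s a => A i (eval a env) == s
  | Sum n f => \sum_(i < eval n env) eval f (val i :: env)
  | Rec n b e f =>
      iteri (eval n env)
        (fun i x => minn (eval f (x :: i :: env)) (eval b env)) (eval e env)
  end.

(** With the environment and the input size at most [x], this bounds not only the value but all head
    positions during the evaluation. Thanks to the cut-off, [Rec] costs one composition with the
    bound of [f] instead of an [n]-fold iterate, so the bound is polynomial. The successor in [Sum]
    keeps the product above its other factor when there are no terms. *)
Fixpoint bnd (e : expr) (x : nat) : nat :=
  match e with
  | Var _ | Size => x
  | Cst k => x + k
  | Add a b => bnd a x + bnd b x
  | Weak _ a => bnd a x
  | Let a b => bnd b (bnd a x)
  | Cond a b c => bnd a x + bnd b x + bnd c x
  | Read _ _ a => (bnd a x).+1
  | Sum n f => bnd f (bnd n x) * (bnd n x).+1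
  | Rec n b e f => bnd f (bnd n x + bnd b x + bnd e x)
  end.

(** Under a binder the argument of [bnd] is raised; the old environment stays below the raised
    argument. *)
Lemma bnd_ge e x : x <= bnd e x.
Proof.
elim: e x => //=.
- by move=> k x; rewrite leq_addr.
- by move=> a IHa b IHb x; rewrite (leq_trans (IHa x)) ?leq_addr.
- by move=> a IHa b IHb x; rewrite (leq_trans (IHa x)).
- by move=> a IHa b IHb c IHc x; rewrite (leq_trans (IHa x)) // -addnA leq_addr.
- by move=> _ _ a IHa x; rewrite (leq_trans (IHa x)).
- move=> n IHn f IHf x; rewrite (leq_trans (IHn x)) // (leq_trans (IHf _)) //.
  by rewrite leq_pmulr.
- move=> n IHn b IHb e IHe f IHf x; apply: leq_trans (IHf _).
  by rewrite -addnA (leq_trans (IHn x)) ?leq_addr.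
Qed.

Lemma bnd_poly e : exists p : {poly nat}, forall x, bnd e x = p.[x]%R.
Proof.
elim: e => /=.
- by move=> _; exists 'X%R => x; rewrite hornerX.
- by exists 'X%R => x; rewrite hornerX.
- by move=> k; exists ('X + k%:P)%R => x; rewrite hornerD hornerX hornerC.
- by move=> a [p Hp] b [q Hq]; exists (p + q)%R => x; rewrite hornerD Hp Hq.
- by move=> k a [p Hp]; exists p.
- by move=> a [p Hp] b [q Hq]; exists (q \Po p)%R => x; rewrite horner_comp Hp Hq.
- move=> a [p Hp] b [q Hq] c [r Hr]; exists (p + q + r)%R => x.
  by rewrite !hornerD Hp Hq Hr.
- by move=> i s a [p Hp]; exists (p + 1%:P)%R => x; rewrite hornerD hornerC -Hp -addn1.
- move=> n [p Hp] f [q Hq]; exists ((q \Po p) * (p + 1%:P))%R => x.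
  by rewrite hornerM horner_comp hornerD hornerC -Hp -Hq -addn1.
- move=> n [p Hp] b [q Hq] e [r Hr] f [s Hs]; exists (s \Po (p + q + r))%R => x.
  by rewrite horner_comp !hornerD -Hp -Hq -Hr -Hs.
Qed.

(** The summand [e0] is for [n = 0], when nothing has been cut off yet. *)
Lemma rec_le n b e0 g : iteri n (fun i x => minn (g i x) b) e0 <= b + e0.
Proof.
case: n => [|n] /=; first by rewrite leq_addl.
by rewrite (leq_trans (geq_minr _ _)) ?leq_addr.
Qed.

Lemma eval_bnd e env x : all (fun v => v <= x) env -> sz <= x ->
  eval e env <= bnd e x.
Proof.
elim: e env x => /=.
- move=> i env x le_env _; case: (ltnP i (size env)) => Hi.
    by apply: (allP le_env); rewrite mem_nth.
  by rewrite nth_default.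
- by [].
- by move=> k env x _ _; rewrite leq_addl.
- by move=> a IHa b IHb env x le1 le2; rewrite leq_add ?IHa ?IHb.
- move=> k a IHa env x /allP le1 le2; apply: IHa => //.
  by apply/allP => v /mem_drop; apply: le1.
- move=> a IHa b IHb env x le1 le2; apply: IHb => /=.
    rewrite IHa //=; apply: sub_all le1 => v /leq_trans; apply; exact: bnd_ge.
  by rewrite (leq_trans le2) ?bnd_ge.
- move=> a _ b IHb c IHc env x le1 le2; case: ifP => _.
    by rewrite (leq_trans (IHc _ _ le1 le2)) ?leq_addl.
  by rewrite (leq_trans (IHb _ _ le1 le2)) // addnAC leq_addl.
- by move=> i s a _ env x _ _; case: eqP.
- move=> n IHn f IHf env x le1 le2.
  apply: (@leq_trans (\sum_(i < eval n env) bnd f (bnd n x))).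
    apply: leq_sum => i _; apply: IHf => /=.
      rewrite (leq_trans (ltnW (ltn_ord i))) ?IHn //=.
      apply: sub_all le1 => v /leq_trans; apply; exact: bnd_ge.
    by rewrite (leq_trans le2) ?bnd_ge.
  by rewrite sum_nat_const card_ord mulnC leq_mul2l ltnW ?orbT // ltnS IHn.
- move=> n IHn b IHb e IHe f IHf env x le1 le2.
  apply: leq_trans (rec_le _ _ _ _) _; apply: leq_trans (bnd_ge _ _).
  by rewrite -addnA (leq_trans _ (leq_addl _ _)) // leq_add ?IHb ?IHe.
Qed.

End Eval.

(* The tapes from 3 on are registers: the value of a register is the position of
   its head, and [mark] in cell 0 makes zero recognizable. *)
Definition good (A : nat -> nat -> symbol) :=
  forall r, 3 <= r -> forall q, A r q = if q == 0 then mark else None.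

Lemma scan_reg H A r : good A -> 3 <= r ->
  (scan (Conf H A) r == mark) = (H r == 0).
Proof. by move=> gA Hr; rewrite /scan /= gA //; case: (H r). Qed.

(** * Register arithmetic *)

Definition inc i : prog := Move Sigma i Right.
Definition dec i : prog := Move Sigma i Left.
Definition dont := Skip Sigma.
Definition upto r p : prog := Until r mark p.
Definition addto r s := upto r (Seq (dec r) (inc s)).
Definition clear r := upto r (dec r).
Definition fork r s t := upto r (Seq (dec r) (Seq (inc s) (inc t))).
Definition back t i := upto t (Seq (dec t) (dec i)).
(** A register can be read only by emptying it, so it is poured into the target and a scratch
    register and refilled from the latter. If the target is a storage tape with its head at 0, the
    head moves to the addressed cell. *)
Definition copy r s t := Seq (fork r s t) (addto t r).

Lemma exec_eq B (p : prog) c c1 c2 : exec B p c c1 -> c1 = c2 -> exec B p c c2.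
Proof. by move=> ex <-. Qed.

Lemma conf_eq H H' (A : nat -> nat -> symbol) : H =1 H' -> Conf H A = Conf H' A.
Proof. by move=> E; congr Conf; apply: functional_extensionality. Qed.

Lemma exec_seq B (p q : prog) c c1 c2 :
  exec B p c c1 -> exec B q c1 c2 -> exec B (Seq p q) c c2.
Proof. by exists c1. Qed.

Lemma exec_skip B c : exec B dont c c.
Proof. by []. Qed.

Lemma exec_if B i s (p q : prog) c c' :
  exec B (if scan c i == s then p else q) c c' -> exec B (If i s p q) c c'.
Proof. by rewrite /exec; case: ifP. Qed.

Lemma exec_inc B i H A : H i < B ->
  exec B (inc i) (Conf H A) (Conf (upd H i (H i).+1) A).
Proof. by move=> le_B; split=> //=; rewrite /upd eqxx. Qed.

Lemma exec_dec B i H A : H i <= B ->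
  exec B (dec i) (Conf H A) (Conf (upd H i (H i).-1) A).
Proof. by move=> le_B; split=> //=; rewrite /upd eqxx /=; lia. Qed.

Lemma exec_stop B i s (p : prog) c : scan c i = s -> exec B (Until i s p) c c.
Proof. exact: UntilStop. Qed.

Lemma exec_step B i s (p : prog) c c1 c2 : scan c i != s ->
  exec B p c c1 -> exec B (Until i s p) c1 c2 -> exec B (Until i s p) c c2.
Proof. exact: UntilStep. Qed.

(** Configurations are numbered by the rounds still to come; for a register counted down this is its
    content. *)
Lemma exec_until B i s (p : prog) (cs : nat -> conf Sigma) n :
    scan (cs 0) i = s -> (forall k, k < n -> scan (cs k.+1) i != s) ->
    (forall k, k < n -> exec B p (cs k.+1) (cs k)) ->
  exec B (Until i s p) (cs n) (cs 0).
Proof.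
move=> E0; elim: n => [|n IH] En ex; first exact: exec_stop.
apply: (exec_step (En n (ltnSn n)) (ex n (ltnSn n))).
by apply: IH => k lt_kn; [apply: En|apply: ex]; apply: ltnW.
Qed.

Lemma exec_upto B r p A (hs : nat -> nat -> nat) H H' :
    good A -> 3 <= r ->
    (forall k, k <= H r -> hs k r = k) ->
    (forall j, H j = hs (H r) j) -> (forall j, H' j = hs 0 j) ->
    (forall k, k < H r -> exec B p (Conf (hs k.+1) A) (Conf (hs k) A)) ->
  exec B (upto r p) (Conf H A) (Conf H' A).
Proof.
move=> gA Hr Ehs EH EH' ex.
rewrite (conf_eq A EH) (conf_eq A EH').
apply: (@exec_until _ _ _ _ (fun k => Conf (hs k) A)) => //.
- by apply/eqP; rewrite scan_reg ?Ehs.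
- by move=> k lt_k; rewrite scan_reg ?Ehs.
Qed.

Lemma addtoP B r s H A : good A -> 3 <= r -> r != s -> H s + H r <= B ->
  exec B (addto r s) (Conf H A) (Conf (upd (upd H s (H s + H r)) r 0) A).
Proof.
move=> gA Hr /eqP nrs le_B.
apply: (@exec_upto _ _ _ _ (fun k => upd (upd H s (H s + (H r - k))) r k)) => //.
- by move=> k _; heads_eq.
- by move=> j; heads_eq.
- by move=> j; heads_eq.
move=> k lt_k; apply: exec_eq.
  apply: exec_seq; [apply: exec_dec | apply: exec_inc]; heads_eq.
by apply: conf_eq => j; heads_eq.
Qed.

Lemma clearP B r H A : good A -> 3 <= r -> H r <= B ->
  exec B (clear r) (Conf H A) (Conf (upd H r 0) A).
Proof.
move=> gA Hr le_B.
apply: (@exec_upto _ _ _ _ (fun k => upd H r k)) => //.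
- by move=> k _; heads_eq.
- by move=> j; heads_eq.
move=> k lt_k; apply: exec_eq; first by apply: exec_dec; heads_eq.
by apply: conf_eq => j; heads_eq.
Qed.

Lemma forkP B r s t H A : good A -> 3 <= r -> r != s -> r != t -> s != t ->
    H s + H r <= B -> H t + H r <= B ->
  exec B (fork r s t) (Conf H A)
    (Conf (upd (upd (upd H s (H s + H r)) t (H t + H r)) r 0) A).
Proof.
move=> gA Hr /eqP nrs /eqP nrt /eqP nst le_B le_B'.
apply: (@exec_upto _ _ _ _
  (fun k => upd (upd (upd H s (H s + (H r - k))) t (H t + (H r - k))) r k)) => //.
- by move=> k _; heads_eq.
- by move=> j; heads_eq.
- by move=> j; heads_eq.
move=> k lt_k; apply: exec_eq.
  apply: exec_seq; [apply: exec_dec | apply: exec_seq; apply: exec_inc]; heads_eq.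
by apply: conf_eq => j; heads_eq.
Qed.

Lemma backP B t i H A : good A -> 3 <= t -> t != i -> H t <= H i <= B ->
  exec B (back t i) (Conf H A) (Conf (upd (upd H i (H i - H t)) t 0) A).
Proof.
move=> gA Ht /eqP nti /andP[le_ti le_B].
apply: (@exec_upto _ _ _ _ (fun k => upd (upd H i (H i - (H t - k))) t k)) => //.
- by move=> k _; heads_eq.
- by move=> j; heads_eq.
- by move=> j; heads_eq.
move=> k lt_k; apply: exec_eq.
  apply: exec_seq; apply: exec_dec; heads_eq.
by apply: conf_eq => j; heads_eq.
Qed.

Lemma copyP B r s t H A : good A -> 3 <= r -> 3 <= t ->
    r != s -> r != t -> s != t -> H t = 0 -> H s + H r <= B ->
  exec B (copy r s t) (Conf H A) (Conf (upd H s (H s + H r)) A).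
Proof.
move=> gA Hr Ht nrs nrt nst Ht0 le_B; apply: exec_eq.
  apply: exec_seq; first by apply: forkP => //; lia.
  apply: addtoP => //; first by rewrite eq_sym.
  by move/eqP: nrs; move/eqP: nrt; move/eqP: nst; heads_eq.
by apply: conf_eq => j; move/eqP: nrs; move/eqP: nrt; move/eqP: nst; heads_eq.
Qed.

(** * Compilation of expressions *)

(* [comp rho d e] leaves the value of [e] in register [d]; the registers above
   [d] serve as scratch space, and [rho] lists the registers holding the
   environment.  Register 3 holds the input size. *)
Fixpoint comp (rho : seq nat) (d : nat) (e : expr) : prog :=
  match e with
  | Var i => if i < size rho then copy (nth 0 rho i) d d.+1 else dont
  | Size => copy 3 d d.+1
  | Cst k => iter k (fun p => Seq p (inc d)) dont
  | Add a b => Seq (comp rho d a) (Seq (comp rho d.+1 b) (addto d.+1 d))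
  | Weak k a => comp (drop k rho) d a
  | Let a b =>
      Seq (comp rho d a)
        (Seq (comp (d :: rho) d.+1 b) (Seq (clear d) (addto d.+1 d)))
  | Cond a b c =>
      Seq (comp rho d a)
        (If d mark (comp rho d c) (Seq (clear d) (comp rho d b)))
  | Read i s a =>
      Seq (comp rho d a)
        (Seq (fork d i d.+1) (Seq (If i s (inc d) dont) (back d.+1 i)))
  | Sum n f =>
      Seq (comp rho d n)
        (Seq (upto d (Seq (dec d) (Seq (comp (d.+1 :: rho) d.+3 f)
                (Seq (addto d.+3 d.+2) (inc d.+1)))))
           (Seq (clear d.+1) (addto d.+2 d)))
  | Rec n b e f =>
      Seq (comp rho d n) (Seq (comp rho d.+1 b) (Seq (comp rho d.+2 e)
        (Seq (upto d (Seq (dec d) (Seq (comp (d.+2 :: d.+3 :: rho) d.+4 f)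
          (Seq (clear d.+2)
          (Seq (upto d.+4 (Seq (dec d.+4)
                 (If d.+1 mark dont (Seq (dec d.+1) (inc d.+2)))))
          (Seq (copy d.+2 d.+1 d.+4) (inc d.+3)))))))
        (Seq (clear d.+1) (Seq (clear d.+3) (addto d.+2 d))))))
  end.

(** Invariant at the entry of code compiled by [comp rho d]. The bound [x] is a parameter of its own
    because it grows when computed values join the environment. *)
Record ready sz x rho d env (H : nat -> nat) A : Prop := Ready {
  ready_good : good A;
  ready_ge : 3 < d;
  ready_zero : forall r, d <= r -> H r = 0;
  ready_regs : all (fun r => 3 <= r < d) rho;
  ready_env : env = map H rho;
  ready_array : forall i, i < 3 -> H i = 0;
  ready_size : H 3 = sz;
  ready_le : all (fun v => v <= x) env;
  ready_szle : sz <= x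
}.

Lemma ready_ext sz x rho d env H A x' d' H' :
  ready sz x rho d env H A -> d <= d' -> x <= x' ->
  (forall r, d' <= r -> H' r = 0) -> (forall r, r < d -> H' r = H r) ->
  ready sz x' rho d' env H' A.
Proof.
case=> gA ged H0 regs E Harr Hsz le_env le_sz le_d le_x H'0 H'E; split=> //.
- exact: leq_trans ged le_d.
- by apply: sub_all regs => r /andP[-> /leq_trans ->].
- by rewrite E; apply/eq_in_map => r /(allP regs) /andP[_ /H'E].
- by move=> i lt_i3; rewrite H'E ?Harr // (leq_trans lt_i3) // ltnW // ltnW.
- by rewrite H'E ?Hsz // ltnW.
- by apply: sub_all le_env => v /leq_trans; apply.
- exact: leq_trans le_sz le_x.
Qed.

Lemma ready_push sz x rho d env H A r v :
  ready sz x rho d env H A -> 3 <= r < d -> H r = v -> v <= x ->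
  ready sz x (r :: rho) d (v :: env) H A.
Proof.
case=> gA ged H0 regs E Harr Hsz le_env le_sz Hr <- le_v; split=> //=.
- by rewrite Hr.
- by rewrite E.
- by rewrite le_v.
Qed.

Lemma ready_drop sz x rho d env H A k : ready sz x rho d env H A ->
  ready sz x (drop k rho) d (drop k env) H A.
Proof.
case=> gA ged H0 regs E Harr Hsz le_env le_sz; split=> //.
- by apply/allP => r /mem_drop; apply/(allP regs).
- by rewrite E map_drop.
- by apply/allP => r /mem_drop; apply/(allP le_env).
Qed.

Lemma ready_next sz x x' rho d env H A v : ready sz x rho d env H A -> x <= x' ->
  ready sz x' rho d.+1 env (upd H d v) A.
Proof.
move=> rd le_x; have H0 := ready_zero rd.
apply: ready_ext rd _ le_x _ _ => // r Hr; rewrite /upd; case: eqP => //; try lia.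
by move=> _; apply: H0; lia.
Qed.

(** Everything but [e] has to vary in the induction: subexpressions run with more occupied registers
    and, under binders, with a longer environment. *)
Lemma comp_exec B sz e rho d env H A x : ready sz x rho d env H A ->
  bnd e x <= B ->
  exec B (comp rho d e) (Conf H A) (Conf (upd H d (eval sz A e env)) A).
Proof.
elim: e rho d env H x.
- move=> i rho d env H x [gA ged H0 regs E Harr Hsz le_env le_sz] /= le_B.
  case: ifP => [lt_i|/negbT]; last first.
    rewrite -leqNgt => le_i; rewrite nth_default; last by rewrite E size_map.
    apply: exec_eq (exec_skip _ _) _.
    by apply: conf_eq => j; move: (H0 d (leqnn d)); heads_eq.
  have /andP[ge3 lt_d] := allP regs _ (mem_nth 0 lt_i).
  have Ev : nth 0 env i = H (nth 0 rho i) by rewrite E (nth_map 0).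
  have le_v : nth 0 env i <= x.
    by apply: (allP le_env); rewrite mem_nth // E size_map.
  move: (nth 0 rho i) ge3 lt_d Ev => r ge3 lt_d Ev.
  apply: exec_eq; first apply: copyP => //;
    rewrite ?(H0 d) ?(H0 d.+1) ?leqnSn //; try lia.
  by rewrite Ev.
- move=> rho d env H x [gA ged H0 regs E Harr Hsz le_env le_sz] /= le_B.
  apply: exec_eq; first apply: copyP => //;
    rewrite ?(H0 d) ?(H0 d.+1) ?leqnSn //; try lia.
  by rewrite Hsz.
- move=> k rho d env H x rd /=.
  have H0 := ready_zero rd (leqnn d); elim: k => [|k IH] /= le_B.
    apply: exec_eq (exec_skip _ _) _; by apply: conf_eq => j; heads_eq.
  apply: exec_eq.
    apply: exec_seq; first by apply: IH; lia.
    by apply: exec_inc; heads_eq.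
  by apply: conf_eq => j; heads_eq.
- move=> a IHa b IHb rho d env H x rd /= le_B.
  have le_a := bnd_ge a x; have le_b := bnd_ge b x.
  have Ha := @eval_bnd _ A a _ _ (ready_le rd) (ready_szle rd).
  have Hb := @eval_bnd _ A b _ _ (ready_le rd) (ready_szle rd).
  have [gA ged H0] := And3 (ready_good rd) (ready_ge rd) (ready_zero rd).
  have H1 := H0 d.+1 (leqnSn d).
  apply: exec_eq.
    apply: exec_seq; first by apply: IHa rd _; lia.
    apply: exec_seq.
      by apply: IHb; [apply: ready_next rd (leqnn _) | lia].
    by apply: addtoP => //; [lia|lia|heads_eq].
  by apply: conf_eq => j; heads_eq.
- by move=> k a IHa rho d env H x rd /= le_B; apply: IHa (ready_drop _ rd) le_B.
- move=> a IHa b IHb rho d env H x rd /= le_B.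
  have le_a := bnd_ge a x; have le_b := bnd_ge b (bnd a x).
  have Ha := @eval_bnd _ A a _ _ (ready_le rd) (ready_szle rd).
  have [gA ged H0] := And3 (ready_good rd) (ready_ge rd) (ready_zero rd).
  have H1 := H0 d.+1 (leqnSn d).
  have rd1 : ready sz (bnd a x) (d :: rho) d.+1 (eval sz A a env :: env)
                (upd H d (eval sz A a env)) A.
    apply: ready_push => //; [exact: ready_next rd _ | lia | by rewrite /upd eqxx].
  have Hb := @eval_bnd _ A b _ _ (ready_le rd1) (ready_szle rd1).
  apply: exec_eq.
    apply: exec_seq; first by apply: IHa rd _; lia.
    apply: exec_seq; first exact: IHb rd1 _.
    apply: exec_seq; first by apply: clearP => //; [lia|heads_eq].
    by apply: addtoP => //; [lia|lia|heads_eq].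
  by apply: conf_eq => j; heads_eq.
- move=> a IHa b IHb c IHc rho d env H x rd /= le_B.
  have Ha := @eval_bnd _ A a _ _ (ready_le rd) (ready_szle rd).
  have [gA ged H0] := And3 (ready_good rd) (ready_ge rd) (ready_zero rd).
  have Hd := H0 d (leqnn d).
  apply: exec_seq; first by apply: IHa rd _; lia.
  apply: exec_if; rewrite scan_reg //; last lia.
  rewrite {1}/upd eqxx; case: ifP => [/eqP ->|_].
    have -> : Conf (upd H d 0) A = Conf H A by apply: conf_eq => j; heads_eq.
    by apply: IHc rd _; lia.
  apply: exec_seq; first by apply: clearP => //; [lia|heads_eq].
  apply: exec_eq; first apply: (IHb _ _ env _ x).
  + by apply: ready_ext rd _ _ _ _ => // r Hr; move: (H0 r); heads_eq.
  + lia.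
  + by apply: conf_eq => j; heads_eq.
- move=> i s a IHa rho d env H x rd /= le_B.
  have Ha := @eval_bnd _ A a _ _ (ready_le rd) (ready_szle rd).
  have [gA ged H0] := And3 (ready_good rd) (ready_ge rd) (ready_zero rd).
  have Hi : H i = 0 by apply: (ready_array rd).
  have Hd1 := H0 d.+1 (leqnSn d); have Hd := H0 d (leqnn d).
  have nid : i <> d :> nat by have := ltn_ord i; lia.
  have nid1 : i <> d.+1 :> nat by have := ltn_ord i; lia.
  set v := eval sz A a env in Ha *.
  apply: exec_seq; first by apply: IHa rd _; lia.
  apply: exec_seq.
    by apply: forkP => //; try lia; rewrite -/v; heads_eq.
  (* After the test, [d.+1] still holds the address by which [back] returns the head of tape [i] to
     cell 0. *)
  pose H1 := upd (upd (upd H d.+1 v) i v) d (A i v == s : nat).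
  apply: (@exec_seq _ _ _ _ (Conf H1 A)).
    apply: exec_if; rewrite -/v /scan /=.
    set H2 := upd _ _ _.
    have E2 : H2 =1 upd (upd (upd H d.+1 v) i v) d 0.
      by move=> j; rewrite /H2; heads_eq.
    have -> : H2 i = v by rewrite E2; heads_eq.
    rewrite (conf_eq A E2) /H1; case: eqP => _; last exact: exec_skip.
    apply: exec_eq; first by apply: exec_inc; heads_eq.
    by apply: conf_eq => j; heads_eq.
  apply: exec_eq; first apply: backP => //; try lia.
    by rewrite /H1; heads_eq.
  by apply: conf_eq => j; rewrite /H1; heads_eq.
- move=> n IHn f IHf rho d env H x rd /= le_B.
  have Hn := @eval_bnd _ A n _ _ (ready_le rd) (ready_szle rd).
  have [gA ged H0] := And3 (ready_good rd) (ready_ge rd) (ready_zero rd).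
  have [Hd Hd1] := conj (H0 d (leqnn d)) (H0 d.+1 (leqnSn d)).
  have [Hd2 Hd3] : H d.+2 = 0 /\ H d.+3 = 0 by split; apply: H0; lia.
  set N := eval sz A n env in Hn *; set X := bnd n x in le_B Hn *.
  have le_x : x <= X := bnd_ge _ _.
  have le_X : X <= bnd f X := bnd_ge _ _.
  pose S k := \sum_(i < k) eval sz A f (val i :: env).
  have leS k : k <= N -> S k <= k * bnd f X.
    move=> le_k; rewrite /S (leq_trans (n := \sum_(i < k) bnd f X)) //; last first.
      by rewrite sum_nat_const card_ord.
    apply: leq_sum => i _.
    apply: eval_bnd => /=; last by rewrite (leq_trans (ready_szle rd)).
    have := ltn_ord i; rewrite (leq_trans _ Hn) ?(leq_trans (ltnW (ltn_ord i))) //= => _.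
    by apply: sub_all (ready_le rd) => u /leq_trans; apply.
  have leSB k : k <= N -> S k <= B.
    by move=> le_k; apply: leq_trans (leS _ le_k) (leq_trans _ le_B); nia.
  have leB2 : X <= B by nia.
  apply: exec_seq; first by apply: IHn rd _.
  rewrite -/N.
  (* With [k] rounds left: [d] counts them, [d.+1] is the summation index, [d.+2] the partial sum;
     the next term goes to [d.+3]. *)
  pose hs k := upd (upd (upd H d k) d.+1 (N - k)) d.+2 (S (N - k)).
  apply: (@exec_seq _ _ _ _ (Conf (hs 0) A)).
    apply: (@exec_upto _ _ _ _ hs) => //.
    + by lia.
    + by move=> k _; rewrite /hs; heads_eq.
    + move=> j; rewrite {2}/upd eqxx /hs subnn /S big_ord0; heads_eq.
    rewrite {1}/upd eqxx => k lt_k.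
    have rdk : ready sz X (d.+1 :: rho) d.+3 (N - k.+1 :: env)
                (upd (hs k.+1) d k) A.
      apply: ready_push; [|lia|by rewrite /hs; heads_eq|lia].
      apply: ready_ext rd _ le_x _ _; first lia.
        by move=> r Hr; move: (H0 r); rewrite /hs; heads_eq.
      by move=> r Hr; rewrite /hs; heads_eq.
    have le_S : S (N - k.+1) + eval sz A f (N - k.+1 :: env) = S (N - k).
      by rewrite (_ : N - k = (N - k.+1).+1) ?/S ?big_ord_recr //=; lia.
    have leS1 := leSB (N - k) (leq_subr _ _).
    have Efk : hs k.+1 d.+2 = S (N - k.+1) by rewrite /hs; heads_eq.
    apply: exec_eq.
      apply: exec_seq; first by apply: exec_dec; rewrite /hs; heads_eq.
      have -> : Conf (upd (hs k.+1) d (hs k.+1 d).-1) A = Conf (upd (hs k.+1) d k) A.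
        by apply: conf_eq => j; rewrite /hs; heads_eq.
      apply: exec_seq; first by apply: IHf rdk _; nia.
      apply: exec_seq.
        by apply: addtoP => //; [lia|move: Efk; heads_eq].
      by apply: exec_inc; rewrite /hs; heads_eq.
    by apply: conf_eq => j; rewrite /hs; move: Hd3; heads_eq.
  have leSN := leSB N (leqnn N).
  apply: exec_eq.
    apply: exec_seq; first by apply: clearP => //; rewrite /hs; heads_eq.
    by apply: addtoP => //; [lia|lia|rewrite /hs ?subn0; heads_eq].
  by apply: conf_eq => j; rewrite /hs -/(S N) subn0; heads_eq.
- move=> n IHn b IHb e IHe f IHf rho d env H x rd /= le_B.
  have Hn := @eval_bnd _ A n _ _ (ready_le rd) (ready_szle rd).
  have Hb := @eval_bnd _ A b _ _ (ready_le rd) (ready_szle rd).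
  have He := @eval_bnd _ A e _ _ (ready_le rd) (ready_szle rd).
  have [gA ged H0] := And3 (ready_good rd) (ready_ge rd) (ready_zero rd).
  have [Hd Hd1] := conj (H0 d (leqnn d)) (H0 d.+1 (leqnSn d)).
  have [Hd2 Hd3] : H d.+2 = 0 /\ H d.+3 = 0 by split; apply: H0; lia.
  have Hd4 : H d.+4 = 0 by apply: H0; lia.
  set N := eval sz A n env in Hn *; set b0 := eval sz A b env in Hb *.
  set e0 := eval sz A e env in He *.
  have le_xn := bnd_ge n x; have le_xb := bnd_ge b x; have le_xe := bnd_ge e x.
  set X := bnd n x + bnd b x + bnd e x in le_B *.
  have le_X : X <= bnd f X := bnd_ge _ _.
  have leXB := leq_trans le_X le_B.
  have [le_Xn le_Xb le_Xe] : [/\ bnd n x <= X, bnd b x <= X & bnd e x <= X].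
    by rewrite /X; split; lia.
  pose r k := iteri k (fun i y => minn (eval sz A f (y :: i :: env)) b0) e0.
  have le_r k : r k <= X by apply: leq_trans (rec_le _ _ _ _) _; rewrite /X; lia.
  apply: exec_seq; first by apply: IHn rd _; lia.
  have rd1 := ready_next N rd (leqnn x).
  apply: exec_seq; first by apply: IHb rd1 _; lia.
  have rd2 := ready_next b0 rd1 (leqnn x).
  apply: exec_seq; first by apply: IHe rd2 _; lia.
  rewrite -/N -/b0 -/e0.
  have leNX : N <= X by rewrite /X; lia.
  have lebX : b0 <= X by rewrite /X; lia.
  have lexX : x <= X by rewrite /X; lia.
  (* With [k] rounds left: [d.+1] keeps the cut-off, [d.+2] the current value, [d.+3] the index; the
     new value goes to [d.+4]. *)
  pose hs k := upd (upd (upd (upd H d k) d.+1 b0) d.+2 (r (N - k))) d.+3 (N - k).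
  apply: (@exec_seq _ _ _ _ (Conf (hs 0) A)).
    apply: (@exec_upto _ _ _ _ hs) => //.
    + by lia.
    + by move=> k _; rewrite /hs; heads_eq.
    + move=> j; have -> : upd (upd (upd H d N) d.+1 b0) d.+2 e0 d = N by heads_eq.
      rewrite /hs subnn /r /=; heads_eq.
    have -> : upd (upd (upd H d N) d.+1 b0) d.+2 e0 d = N by heads_eq.
    move=> k lt_k; have := le_r (N - k.+1); set y := r (N - k.+1) => le_y.
    have rdk : ready sz X (d.+2 :: d.+3 :: rho) d.+4 (y :: N - k.+1 :: env)
                (upd (hs k.+1) d k) A.
      apply: ready_push; [|lia|by rewrite /hs -/y; heads_eq|lia].
      apply: ready_push; [|lia|by rewrite /hs; heads_eq|lia].
      apply: ready_ext rd _ lexX _ _; first lia.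
        by move=> q Hq; move: (H0 q); rewrite /hs; heads_eq.
      by move=> q Hq; rewrite /hs; heads_eq.
    have Hv := @eval_bnd _ A f _ _ (ready_le rdk) (ready_szle rdk).
    set v := eval sz A f _ in Hv.
    (* Computes the minimum of [v] and [b0]: while [d.+4] is counted down from [v], units pass from
       [d.+1] to [d.+2] as long as there are any. Adding [d.+2] back to [d.+1] then restores the
       cut-off. *)
    pose gs l := upd (upd (upd (upd (upd H d k) d.+1 (b0 - minn (v - l) b0))
        d.+2 (minn (v - l) b0)) d.+3 (N - k.+1)) d.+4 l.
    have Er : r (N - k) = minn v b0 by rewrite (_ : N - k = (N - k.+1).+1) //; lia.
    apply: exec_eq.
      apply: exec_seq; first by apply: exec_dec; rewrite /hs; heads_eq.
      have -> : Conf (upd (hs k.+1) d (hs k.+1 d).-1) A = Conf (upd (hs k.+1) d k) A.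
        by apply: conf_eq => j; rewrite /hs; heads_eq.
      apply: exec_seq; first by apply: IHf rdk _; lia.
      rewrite -/v.
      apply: exec_seq; first by apply: clearP => //; rewrite /hs -/y; heads_eq.
      apply: (@exec_seq _ _ _ _ (Conf (gs 0) A)).
        apply: (@exec_upto _ _ _ _ gs) => //.
        + by move=> l _; rewrite /gs; heads_eq.
        + move=> j.
          have -> : upd (upd (upd (hs k.+1) d k) d.+4 v) d.+2 0 d.+4 = v by heads_eq.
          by rewrite /gs subnn min0n /hs; heads_eq.
        have -> : upd (upd (upd (hs k.+1) d k) d.+4 v) d.+2 0 d.+4 = v by heads_eq.
        move=> l lt_l.
        apply: exec_seq; first by apply: exec_dec; rewrite /gs; heads_eq.
        apply: exec_if; rewrite scan_reg //; last by lia.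
        case: ifP => [/eqP Eb|/eqP Eb].
          apply: exec_eq (exec_skip _ _) _; apply: conf_eq => j.
          by move: Eb; rewrite /gs; heads_eq.
        apply: exec_eq.
          apply: exec_seq; first by apply: exec_dec; move: Eb; rewrite /gs; heads_eq.
          by apply: exec_inc; move: Eb; rewrite /gs; heads_eq.
        by apply: conf_eq => j; move: Eb; rewrite /gs; heads_eq.
      apply: exec_seq.
        by apply: copyP => //; try lia; rewrite /gs subn0; heads_eq.
      by apply: exec_inc; rewrite /gs; heads_eq.
    by apply: conf_eq => j; rewrite /gs /hs Er; heads_eq.
  have := le_r N => leN.
  apply: exec_eq.
    apply: exec_seq; first by apply: clearP => //; rewrite /hs; heads_eq.
    apply: exec_seq; first by apply: clearP => //; rewrite /hs; heads_eq.
    by apply: addtoP => //; [lia|lia|rewrite /hs ?subn0; heads_eq].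
  by apply: conf_eq => j; rewrite /hs -/(r N) subn0; heads_eq.
Qed.

End Expressions.

(** * Iterating an expression on a stored bit string *)


Section Iteration.

Variable Sigma : finType.
Local Notation symbol := (symbol Sigma).
Local Notation prog := (prog Sigma).
Local Notation expr := (expr Sigma).
Local Notation mark := (mark Sigma).

Fixpoint reads (i : nat) (e : expr) : bool :=
  match e with
  | Var _ | Size | Cst _ => false
  | Weak _ a => reads i a
  | Add a b | Let a b | Sum a b => reads i a || reads i b
  | Cond a b c => [|| reads i a, reads i b | reads i c]
  | Read j _ a => (i == j) || reads i a
  | Rec a b c d => [|| reads i a, reads i b, reads i c | reads i d]
  end.

Lemma eval_ext sz (A A' : nat -> nat -> symbol) e env :
  (forall i : 'I_3, reads i e -> A i =1 A' i) -> eval sz A e env = eval sz A' e env.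
Proof.
elim: e env => //=.
- by move=> a IHa b IHb env H; rewrite IHa ?IHb // => i Hi; apply: H; rewrite Hi ?orbT.
- by move=> k a IHa env H; apply: IHa.
- by move=> a IHa b IHb env H; rewrite IHa ?IHb // => i Hi; apply: H; rewrite Hi ?orbT.
- by move=> a IHa b IHb c IHc env H; rewrite IHa ?IHb ?IHc // => i Hi;
    apply: H; rewrite Hi ?orbT.
- move=> i s a IHa env H; rewrite IHa; last by move=> j Hj; apply: H; rewrite Hj orbT.
  by rewrite H // eqxx.
- move=> n IHn f IHf env H; rewrite IHn; last by move=> j Hj; apply: H; rewrite Hj.
  by apply: eq_bigr => i _; apply: IHf => j Hj; apply: H; rewrite Hj orbT.
- move=> n IHn b IHb e IHe f IHf env H.
  rewrite IHn ?IHb ?IHe; try by move=> j Hj; apply: H; rewrite Hj ?orbT.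
  apply: eq_iteri => i x; rewrite IHf // => j Hj; apply: H; by rewrite Hj !orbT.
Qed.

Definition bit (b : bool) : symbol := if b then mark else None.

(* Tape 1 stores the current bit string, tape 2 buffers its successor. *)
Definition tapes_of (w : seq Sigma) (S S' : nat -> bool) (i q : nat) : symbol :=
  match i with
  | 0 => nth None [seq Some (inl a) | a <- w] q
  | 1 => bit (S q)
  | 2 => bit (S' q)
  | _ => if q == 0 then mark else None
  end.

Lemma tapes_of_good w S S' : good (tapes_of w S S').
Proof. by move=> [|[|[|r]]]. Qed.

(* Writes the truth values of [F] at [0, ..., m - 1] to tape [a]. *)
Definition fill (a : nat) (m F : expr) : prog :=
  Seq (comp [::] 4 m)
    (Seq (upto 4 (Seq (dec _ 4) (Seq (comp [:: 5] 6 F) (Seq (copy _ 5 a 7)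
       (Seq (If 6 mark (Put a None) (Seq (clear _ 6) (Put a mark)))
       (Seq (copy _ 5 7 8) (Seq (back _ 7 a) (inc _ 5))))))))
    (clear _ 5)).

Definition filled (A : nat -> nat -> symbol) a n (f : nat -> nat) :=
  upd A a (fun q => if q < n then bit (f q != 0) else A a q).

(** Head positions between two phases of the program: only the input size is kept in a register. *)
Definition rest (sz r : nat) : nat := if r == 3 then sz else 0.

Lemma ready_rest sz x (A : nat -> nat -> symbol) :
  good A -> sz <= x -> ready sz x [::] 4 [::] (rest sz) A.
Proof.
move=> gA le_sz; split=> //.
  by move=> [|[|[|[|r]]]].
by move=> [|[|[|r]]].
Qed.

Lemma exec_put B a s H (A : nat -> nat -> symbol) :
  exec B (Put a s) (Conf H A) (Conf H (upd A a (upd (A a) (H a) s))).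
Proof. by []. Qed.

(** The last hypothesis keeps [F] independent of the tape being overwritten; this is why the
    successor of the bit string goes to a buffer first. *)
Lemma fill_exec B a m F sz A : 0 < a < 3 -> good A ->
    bnd F (bnd m sz) <= B ->
    (forall A' env, (forall i, i <> a -> A' i = A i) ->
       eval sz A' F env = eval sz A F env) ->
  exec B (fill a m F) (Conf (rest sz) A)
    (Conf (rest sz)
       (filled A a (eval sz A m [::]) (fun q => eval sz A F [:: q]))).
Proof.
move=> Ha gA le_B EF; have rd := ready_rest gA (leqnn sz).
set X := bnd m sz in le_B.
have le_X : X <= B := leq_trans (bnd_ge _ _) le_B.
have le_sz : sz <= X := bnd_ge _ _.
set N := eval sz A m [::]; set f := fun q => _.
have le_N : N <= X by apply: eval_bnd.
apply: exec_seq; first exact: comp_exec rd le_X.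
rewrite -/N.
pose hs k := upd (upd (rest sz) 4 k) 5 (N - k).
(* [k] cells are still to be written; register 5 points to the next one. *)
pose cs k := Conf (hs k) (filled A a (N - k) f).
have gk k : good (filled A a k f).
  by move=> r Hr q; rewrite /filled /upd; case: eqP => [E|_]; [lia|apply: gA].
apply: (@exec_seq _ _ _ _ _ (cs 0)).
  have -> : Conf (upd (rest sz) 4 N) A = cs N.
    rewrite /cs subnn; congr Conf.
      by apply: functional_extensionality => j; rewrite /hs /rest; heads_eq.
    apply: functional_extensionality => j; rewrite /filled /upd.
    by case: eqP => [->|].
  apply: exec_until.
  - by apply/eqP; rewrite scan_reg.
  - by move=> k lt_k; rewrite scan_reg.
  move=> k lt_k.
  have Ek : N - k = (N - k.+1).+1 by lia.
  set q := N - k.+1 in Ek; set A1 := filled A a q f.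
  have rd1 : ready sz X [:: 5] 6 [:: q] (upd (hs k.+1) 4 k) A1.
    apply: ready_push => //; last by rewrite /q; lia.
    apply: ready_ext (ready_rest (gk q) le_sz) _ _ _ _ => // r Hr;
    by rewrite /hs /rest; heads_eq.
  have Ev : eval sz A1 F [:: q] = f q.
    by rewrite EF // => i Hi; rewrite /A1 /filled /upd; case: eqP.
  have leF : f q <= B.
    rewrite -Ev; apply: leq_trans (eval_bnd _ _ (ready_le rd1) (ready_szle rd1)) le_B.
  have Hra : rest sz a = 0 by rewrite /rest; case: eqP => //; lia.
  have le_q : q <= X by rewrite /q; lia.
  apply: exec_seq; first by apply: exec_dec; rewrite /hs; heads_eq.
  rewrite -/q.
  have -> : Conf (upd (hs k.+1) 4 (hs k.+1 4).-1) A1 = Conf (upd (hs k.+1) 4 k) A1.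
    by [].
  apply: exec_seq; first exact: comp_exec rd1 le_B.
  rewrite Ev.
  apply: exec_seq.
    apply: copyP; [exact: gk|by []|by []|lia|lia|lia|by []|].
    by move: Hra; rewrite /hs -/q; heads_eq.
  set H1 := upd _ a _.
  have E1 : H1 =1 upd (upd (upd (upd (rest sz) 4 k) 5 q) 6 (f q)) a q.
    by move=> j; move: Hra; rewrite /H1 /hs -/q; heads_eq.
  rewrite (conf_eq _ E1) {H1 E1}; set H1 := upd _ a _.
  (* The value has been used up; the head of tape [a] is still at cell [q] and has to be led
     back. *)
  pose H2 := upd (upd (upd (rest sz) 4 k) 5 q) a q.
  pose A2 := filled A a (N - k) f.
  have EA2 : upd A1 a (upd (A1 a) q (bit (f q != 0))) = A2.
    apply: functional_extensionality => j; rewrite /A2 /A1 /filled /upd.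
    case: eqP => // _; rewrite eqxx; apply: functional_extensionality => u.
    by rewrite Ek ltnS (leq_eqVlt u); case: eqP => [->|_]; rewrite ?eqxx.
  have H1a : H1 a = q by rewrite /H1 /upd eqxx.
  have H2a : H2 a = q by rewrite /H2 /upd eqxx.
  have H16 : H1 6 = f q by rewrite /H1; heads_eq.
  apply: (@exec_seq _ _ _ _ _ (Conf H2 A2)).
    apply: exec_if; rewrite scan_reg //; last exact: gk.
    rewrite H16; case: eqP => [Ef|/eqP nf].
      apply: exec_eq (exec_put _ _ _ _ _) _; rewrite H1a.
      rewrite -EA2 Ef /= ; apply: conf_eq => j; move: Hra Ef; rewrite /H1 /H2.
      by rewrite /rest; heads_eq.
    apply: exec_seq; first by apply: clearP; [exact: gk|by []|rewrite H16].
    apply: exec_eq (exec_put _ _ _ _ _) _.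
    have -> : upd H1 6 0 a = q by rewrite /H1; heads_eq.
    rewrite -EA2 nf /=; apply: conf_eq => j; move: Hra; rewrite /H1 /H2.
    by rewrite /rest; heads_eq.
  have g2 : good A2 by apply: gk.
  have Hz7 : H2 7 = 0 by rewrite /H2 /rest; heads_eq.
  have Hz8 : H2 8 = 0 by rewrite /H2 /rest; heads_eq.
  have H5 : H2 5 = q by rewrite /H2; heads_eq.
  apply: exec_eq.
    apply: exec_seq; first by apply: copyP => //; lia.
    rewrite Hz7 H5 add0n.
    apply: exec_seq.
      by apply: backP => //; [lia|rewrite [upd _ _ _ 7]/upd /= /upd; case: eqP; lia].
    by apply: exec_inc; rewrite /H2; move: Hra; heads_eq.
  rewrite /cs -/A2; apply: conf_eq => j; rewrite /hs Ek.
  by move: Hra; rewrite /H2 /rest; heads_eq.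
rewrite /cs subn0; apply: exec_eq.
  apply: clearP; [exact: gk|by []|].
  by rewrite /hs; heads_eq.
by apply: conf_eq => j; rewrite /hs /rest; heads_eq.
Qed.

(** * The complete program and its space bound *)

Definition init (K : nat) : prog :=
  foldr (fun i p => Seq (Put i mark) p) (dont _) (iota 3 K).

(** Register 4 counts along with register 3 so that it can lead the input head back to cell 0. *)
Definition get_size : prog :=
  Seq (Until 0 None (Seq (inc _ 0) (Seq (inc _ 3) (inc _ 4)))) (back _ 4 0).

Definition read_buffer : expr := Read (inord 2) mark (Var _ 0).

Definition iteration (m F C R : expr) : prog :=
  Seq get_size (Seq (comp [::] 4 C)
    (Seq (upto 4 (Seq (clear _ 4) (Seq (fill 2 m F)
            (Seq (fill 1 m read_buffer) (comp [::] 4 C)))))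
       (comp [::] 4 R))).

(** A configuration has infinitely many tapes, the machine finitely many. The tapes beyond it may be
    given any contents; they carry the mark from the outset, so that [good] holds of all
    registers. *)
Lemma init_exec B K (A : nat -> nat -> symbol) :
  (forall i q, 3 <= i -> A i q = if (q == 0) && (3 + K <= i) then mark else None) ->
  exists A', [/\ exec B (init K) (Conf (fun=> 0) A) (Conf (fun=> 0) A'),
    good A' & forall i, i < 3 -> A' i = A i].
Proof.
move=> EA; rewrite /init.
pose A' j i q := if (2 < i < j) && (q == 0) then mark else A i q.
have gA' : good (A' (3 + K)).
  by move=> r Hr q; rewrite /A' EA // Hr /=; case: leqP; case: eqP.
exists (A' (3 + K)); split=> //; last first.
  move=> i Hi; apply: functional_extensionality => q; rewrite /A'.
  by case: (ltnP 2 i) => //=; lia.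
have -> : A = A' 3.
  apply: functional_extensionality => i; apply: functional_extensionality => q.
  by rewrite /A'; case: ifP => //; lia.
suff H n j : 2 < j -> exec B (foldr (fun i p => Seq (Put i mark) p) (dont _) (iota j n))
    (Conf (fun=> 0) (A' j)) (Conf (fun=> 0) (A' (j + n))) by apply: H.
elim: n j => [|n IH] j Hj /=; first by rewrite addn0; apply: exec_skip.
apply: exec_seq; first exact: exec_put.
rewrite (_ : upd _ _ _ = A' j.+1) ?addnS -?addSn; first by apply: IH; lia.
apply: functional_extensionality => i; apply: functional_extensionality => q.
rewrite /A' /upd; case: (i =P j) => [->|nij].
  by rewrite Hj ltnn ltnSn /=; case: eqP.
by congr (if _ then _ else _); congr (_ && _); lia.
Qed.

Lemma get_size_exec B w S S' : size w <= B ->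
  exec B get_size (Conf (fun=> 0) (tapes_of w S S'))
    (Conf (rest (size w)) (tapes_of w S S')).
Proof.
move=> le_B; have gA := tapes_of_good w S S'; set A := tapes_of w S S' in gA *.
pose hs k := upd (upd (upd (fun=> 0) 0 (size w - k)) 3 (size w - k)) 4 (size w - k).
apply: exec_eq.
  apply: (@exec_seq _ _ _ _ _ (Conf (hs 0) A)).
    have -> : Conf (fun=> 0) A = Conf (hs (size w)) A.
      by apply: conf_eq => j; rewrite /hs subnn; heads_eq.
    apply: (@exec_until _ _ _ _ _ (fun k => Conf (hs k) A)).
    - by rewrite /scan /hs /= nth_default ?size_map ?subn0.
    - move=> k lt_k; rewrite /scan /hs /= /upd /=.
      case: w le_B hs A gA lt_k => // a w _ _ _ _ lt_k.
      by rewrite (nth_map a) //=; lia.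
    move=> k lt_k; apply: exec_eq.
      do 2!(apply: exec_seq; first by apply: exec_inc; rewrite /hs; heads_eq).
      by apply: exec_inc; rewrite /hs; heads_eq.
    by apply: conf_eq => j; rewrite /hs; heads_eq.
  by apply: backP => //; rewrite /hs /upd /=; lia.
by apply: conf_eq => j; rewrite /hs /rest; heads_eq.
Qed.

Definition run (e : expr) (w : seq Sigma) (S : nat -> bool) (env : seq nat) : nat :=
  eval (size w) (tapes_of w S (fun=> false)) e env.

Lemma eval_run e w S S' env : ~~ reads 2 e ->
  eval (size w) (tapes_of w S S') e env = run e w S env.
Proof.
move=> n2; apply: eval_ext => -[[|[|[|i]]] Hi] //=.
by rewrite (negPf n2).
Qed.

Definition next (m F : expr) (w : seq Sigma) (S : nat -> bool) : nat -> bool :=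
  fun q => if q < run m w S [::] then run F w S [:: q] != 0 else S q.

Lemma filled1 w S S' n f : filled (tapes_of w S S') 1 n f =
  tapes_of w (fun q => if q < n then f q != 0 else S q) S'.
Proof.
apply: functional_extensionality => i; apply: functional_extensionality => q.
by case: i => [|[|i]] //=; rewrite /filled /upd /=; case: ifP.
Qed.

Lemma filled2 w S S' n f : filled (tapes_of w S S') 2 n f =
  tapes_of w S (fun q => if q < n then f q != 0 else S' q).
Proof.
apply: functional_extensionality => i; apply: functional_extensionality => q.
by case: i => [|[|[|i]]] //=; rewrite /filled /upd /=; case: ifP.
Qed.

Section Scheme.

Variables m F C R : expr.
Hypotheses (m2 : ~~ reads 2 m) (F2 : ~~ reads 2 F) (C2 : ~~ reads 2 C)
  (R2 : ~~ reads 2 R).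

(** The buffer keeps leftovers of the previous round, hence the arbitrary [S'] and the existential
    [S'']; none of the given expressions reads tape 2. *)
Lemma loop_exec B w S S' T :
    let sz := size w in
    [/\ bnd F (bnd m sz) <= B, bnd read_buffer (bnd m sz) <= B & bnd C sz <= B] ->
    (forall k, k < T -> run C w (iter k (next m F w) S) [::] != 0) ->
    run C w (iter T (next m F w) S) [::] = 0 ->
  exists S'', exec B
    (upto 4 (Seq (clear _ 4) (Seq (fill 2 m F)
            (Seq (fill 1 m read_buffer) (comp [::] 4 C)))))
    (Conf (upd (rest sz) 4 (run C w S [::])) (tapes_of w S S'))
    (Conf (rest sz) (tapes_of w (iter T (next m F w) S) S'')).
Proof.
move=> sz [le_F le_b le_C]; elim: T S S' => [|T IH] S S' go stop.
  exists S'; rewrite [run C _ _ _]stop.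
  rewrite (@conf_eq _ _ (rest sz)); last by move=> j; rewrite /rest; heads_eq.
  by apply: exec_stop; apply/eqP; rewrite scan_reg //; apply: tapes_of_good.
have leC : run C w S [::] <= B by apply: leq_trans le_C; apply: eval_bnd.
(* The buffer after the first [fill]. *)
pose S1 q := if q < run m w S [::] then run F w S [:: q] != 0 else S' q.
have [||S'' ex] := IH (next m F w S) S1.
- by move=> k lt_k; rewrite -iterSr; apply: go.
- by rewrite -iterSr.
exists S''; rewrite iterSr.
apply: exec_step ex.
  rewrite scan_reg //; last exact: tapes_of_good.
  by apply: (go 0).
apply: exec_seq.
  by apply: clearP => //; apply: tapes_of_good.
rewrite (@conf_eq _ _ (rest sz)); last by move=> j; rewrite /rest; heads_eq.
apply: exec_seq.
  apply: fill_exec => //; first exact: tapes_of_good.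
  move=> A' env EA; apply: eval_ext => i Hi; rewrite EA // => i2.
  by move: F2; rewrite -i2 Hi.
rewrite filled2 eval_run //.
rewrite (_ : (fun q => if _ then _ else S' q) = S1); last first.
  by apply: functional_extensionality => q; rewrite eval_run.
apply: exec_seq.
  apply: fill_exec => //; first exact: tapes_of_good.
  move=> A' env EA; apply: eval_ext => i /=.
  by rewrite orbF inordK // => /eqP ->; rewrite EA.
rewrite filled1 eval_run //.
rewrite (_ : (fun q => if _ then _ else S q) = next m F w S); last first.
  apply: functional_extensionality => q; rewrite /next /= inordK //.
  by case: ifP => // lt_q; rewrite /= /S1 lt_q; case: (run F w S [:: q] != 0).
rewrite -(@eval_run C w _ S1) //; apply: comp_exec (le_C).
exact: ready_rest (tapes_of_good _ _ _) _.
Qed.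

Lemma iteration_exec B w T :
    let sz := size w in let S := fun=> false in
    sz <= B ->
    [/\ bnd F (bnd m sz) <= B, bnd read_buffer (bnd m sz) <= B & bnd C sz <= B] ->
    bnd R sz <= B ->
    (forall k, k < T -> run C w (iter k (next m F w) S) [::] != 0) ->
    run C w (iter T (next m F w) S) [::] = 0 ->
  exists A', good A' /\ exec B (iteration m F C R)
    (Conf (fun=> 0) (tapes_of w S S))
    (Conf (upd (rest sz) 4 (run R w (iter T (next m F w) S) [::])) A').
Proof.
move=> sz S le_sz le_B le_R go stop; have [_ _ le_C] := le_B.
have [S'' ex] := loop_exec S le_B go stop.
exists (tapes_of w (iter T (next m F w) S) S''); split; first exact: tapes_of_good.
apply: exec_seq; first exact: get_size_exec.
apply: exec_seq.
  apply: comp_exec (le_C); exact: ready_rest (tapes_of_good _ _ _) _.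
rewrite eval_run //; apply: exec_seq ex _.
rewrite -(@eval_run R w _ S'') //; apply: comp_exec (le_R).
exact: ready_rest (tapes_of_good _ _ _) _.
Qed.

(** The number [T] of rounds may depend on [w] in any way, for only space is bounded. *)
Theorem iteration_PSPACE (L : seq Sigma -> Prop) :
  (forall w, exists T, let St k := iter k (next m F w) (fun=> false) in
    [/\ forall k, k < T -> run C w (St k) [::] != 0,
        run C w (St T) [::] = 0 & run R w (St T) [::] != 0 <-> L w]) ->
  PSPACE L.
Proof.
move=> HL; pose p := iteration m F C R; pose K := max_tape p.
(* [init K.+1] marks the tapes 3 to [3 + K], exactly the registers of this machine; register 4
   receives the result. *)
pose M := machine (3 + K) (Seq (init K.+1) p) 4 mark.
have le_init j n : max_tape (foldr (fun i p => Seq (Put i mark) p) (dont _)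
    (iota j n)) <= (j + n).-1.
  by elim: n j => //= n IH j; have := IH j.+1; rewrite geq_max; lia.
have le_pK : max_tape (Seq (init K.+1) p) <= 3 + K.
  rewrite -[max_tape _]/(maxn (max_tape (init K.+1)) K) geq_max leq_addl andbT.
  by apply: leq_trans (le_init _ _) _; lia.
have le_4 : 4 <= 3 + K.
  by rewrite (leq_trans _ (leq_addl 3 K)) // /K /p /= !leq_max.
have [[p1 E1] [p2 E2] [p3 E3] [p4 E4] [p5 E5]] :=
  And5 (bnd_poly m) (bnd_poly F) (bnd_poly read_buffer) (bnd_poly C) (bnd_poly R).
pose P := ((p2 \Po p1) + (p3 \Po p1) + p4 + p5 + 'X + 1%:P)%R : {poly nat}.
have main w : exists b : bool, [/\ b <-> L w,
    exists t, cfg_state (tm_run M w t) = inr (Some b) &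
    forall t i, cfg_head (tm_run M w t) i < P.[size w]%R].
  have [T [go stop RL]] := HL w; set sz := size w.
  pose B := bnd F (bnd m sz) + bnd read_buffer (bnd m sz) + bnd C sz + bnd R sz + sz.
  have EP : P.[sz]%R = B.+1.
    by rewrite /P !hornerD !horner_comp hornerX hornerC -E1 -E2 -E3 -E4 -E5 -addn1.
  pose A0 i q : symbol := if i < 3 then tapes_of w (fun=> false) (fun=> false) i q
    else if (q == 0) && (3 + K.+1 <= i) then mark else None.
  have [A1 [ex1 g1 E01]] : exists A', [/\ exec B (init K.+1) (Conf (fun=> 0) A0)
      (Conf (fun=> 0) A'), good A' & forall i, i < 3 -> A' i = A0 i].
    by apply: init_exec => i q Hi; rewrite /A0 ltnNge Hi.
  have EA1 : A1 = tapes_of w (fun=> false) (fun=> false).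
    apply: functional_extensionality => i; apply: functional_extensionality => q.
    case: (ltnP i 3) => Hi; first by rewrite E01 // /A0 Hi.
    by rewrite g1 //; case: i Hi => [|[|[|i]]].
  have [|||A2 [g2 ex2]] := @iteration_exec B w T _ _ _ go stop.
  - by rewrite -/sz /B; lia.
  - by rewrite -/sz /B; split; lia.
  - by rewrite -/sz /B; lia.
  rewrite -/sz EA1 in ex1 ex2.
  have ex := exec_seq ex1 ex2.
  have [|[t Et] Hh] := @machine_run _ (3 + K) _ 4 mark le_pK le_4 B _ _ ex; first by [].
  set b := run R w _ _ in RL ex2 ex Et; exists (b != 0).
  have Einit : tm_init M w =
      @machine_conf _ (3 + K) _ 4 mark (inl (pstart (Seq (init K.+1) p)))
        (Conf (fun=> 0) A0).
    congr TMConfig; apply: functional_extensionality => i.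
    apply: functional_extensionality => q /=; rewrite /A0.
    case: eqP => [->|/eqP ni0] //=; case: ltnP => [lt_i|le_i].
      by case: i ni0 lt_i => -[|[|[|i]]] Hi.
    by rewrite leqNgt addnS ltn_ord andbF.
  split=> //.
    exists t; rewrite /tm_run Einit Et; congr (inr (Some _)).
    by rewrite scan_reg.
  by move=> u i; rewrite EP ltnS /tm_run Einit.
exists M, P; split; last by move=> w t i; have [b [_ _ H]] := main w.
move=> w; have [b [bL [t Et] _]] := main w; split=> HLw; exists t; rewrite Et.
  by move/bL: HLw => ->.
by case: b bL {Et} => // -[/(_ isT)].
Qed.

End Scheme.

End Iteration.

(** * Winning positions of the game *)

Section Winning.

Variables (V : finType) (G : epgraph V).

Definition cop_move (t : nat) (X : V -> V -> bool) (c r c' : V) : bool :=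
  legal_move G t c c' && ((c' == r) || [forall r', legal_move G t r r' ==> X c' r']).

Definition win_step (t : nat) (X : V -> V -> bool) (c r : V) : bool :=
  [exists c', cop_move t X c r c'].

(* The cop, to move in time step [t], can catch the robber within [k] moves. *)
Fixpoint win (k t : nat) : V -> V -> bool :=
  if k is k'.+1 then win_step t (win k' t.+1) else fun _ _ => false.

(** The strategy replays the history to recover the position of the cop and the time, then makes a
    move that preserves a win within the remaining moves. *)
Lemma win_strategy K c0 : (forall r0, win K 0 c0 r0) -> cop_winning G.
Proof.
move=> Hwin.
(* After a catch or beyond the horizon no such move need exist; staying put is always legal. *)
pose mv t c r := odflt c [pick c' | cop_move t (win (K - t).-1 t.+1) c r c'].
pose pos h := (foldl (fun x r => (mv x.2 x.1 r, x.2.+1)) (c0, 0) h).1.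
exists c0, pos => r rP.
have size_pos t : (foldl (fun x r => (mv x.2 x.1 r, x.2.+1)) (c0, 0) (mkseq r t)).2 = t.
  by elim: t => // t IH; rewrite mkseqS foldl_rcons /= IH.
have posE t : cop_pos c0 pos r t = pos (mkseq r t) by case: t.
have posS t : pos (mkseq r t.+1) = mv t (pos (mkseq r t)) (r t).
  by rewrite /pos mkseqS foldl_rcons /= size_pos.
split=> [t|].
  rewrite !posE posS /mv; case: pickP => [c' /andP[]//|_] /=.
  by rewrite /legal_move eqxx.
have inv t : t <= K -> (exists u, cop_pos c0 pos r u.+1 = r u) \/
    win (K - t) t (pos (mkseq r t)) (r t).
  elim: t => [|t IH] le_t; first by right; rewrite subn0.
  case: (IH (ltnW le_t)) => [|H]; first by left.
  move: H; have E : K - t = (K - t.+1).+1 by lia.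
  rewrite E => H; rewrite posS.
  have {}H : cop_move t (win (K - t).-1 t.+1) (pos (mkseq r t)) (r t)
    (mv t (pos (mkseq r t)) (r t)).
    rewrite /mv; case: pickP => [//|no]; case/existsP: H => c' Hc'.
    by have := no c'; rewrite E /= Hc'.
  case/andP: H => _ /orP[/eqP H|/forallP/(_ (r t.+1))].
    by left; exists t; rewrite posE posS.
  by rewrite rP E /= => ?; right.
have [//|] := inv K (leqnn K).
by rewrite subnn.
Qed.

(** * Time modulo a common period, and the fixed point *)

Variable L : nat.
Hypotheses (L_gt0 : 0 < L)
  (L_div : forall e, e \in ep_edges G -> size (ep_tau G e) %| L).

Lemma legal_mod t u v : legal_move G (t %% L) u v = legal_move G t u v.
Proof.
rewrite /legal_move /present; congr (_ || _).
by case: (boolP (_ \in _)) => //= He; rewrite modn_dvdm ?L_div.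
Qed.

Definition phase (t : nat) : 'I_L := Ordinal (ltn_pmod t L_gt0).

(** Backward step on a finite set of positions, where a monotone operator reaches its least fixed
    point after at most as many iterations as there are positions. *)
Definition attract (X : {set V * V * 'I_L}) : {set V * V * 'I_L} :=
  [set x : V * V * 'I_L |
    win_step x.2 (fun c r => (c, r, phase x.2.+1) \in X) x.1.1 x.1.2].

Lemma attract_mono : {homo attract : X Y / X \subset Y}.
Proof.
move=> X Y /subsetP sXY; apply/subsetP => x; rewrite !inE.
case/existsP => c' /andP[lc H]; apply/existsP; exists c'; rewrite /cop_move lc /=.
case/orP: H => [->//|/forallP H]; apply/orP; right; apply/forallP => r'.
by apply/implyP => lr; apply/sXY/(implyP (H r')).
Qed.

Lemma win_attract k t c r :
  win k t c r = ((c, r, phase t) \in iter k attract set0).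
Proof.
elim: k t c r => [|k IH] t c r; first by rewrite inE.
rewrite iterS inE /win_step /=; apply: eq_existsb => c'.
rewrite /cop_move legal_mod; congr (_ && (_ || _)); apply: eq_forallb => r'.
rewrite legal_mod IH; congr (_ ==> _).
suff -> : phase t.+1 = phase (phase t).+1 by [].
by apply: val_inj; rewrite /= -[in RHS]addn1 modnDml addn1.
Qed.

Lemma win_fix K : #|V| * #|V| * L <= K ->
  forall t c r, win K t c r = win_step t (win K t.+1) c r.
Proof.
move=> le_K t c r.
have E : iter K attract set0 = fixset attract.
  apply/eqP; rewrite eqEsubset iter_sub_fix; last exact: attract_mono.
  (* [fixset] is the iterate whose number is the number of positions; being fixed, it survives the
     further iterations up to [K]. *)
  have <- : iter (K - #|{: V * V * 'I_L}|) attract (fixset attract) = fixset attract.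
    by rewrite fixsetKn //; exact: attract_mono.
  by rewrite /fixset -iterD subnK ?subxx // !card_prod card_ord.
have -> : win_step t (win K t.+1) c r = win K.+1 t c r by [].
by rewrite !win_attract iterS E fixsetK //; exact: attract_mono.
Qed.

(** If no start vertex wins within [K] moves, stability of the region gives the robber, against each
    cop move, an answer that stays outside it. Played against any strategy, these answers form an
    infinite escape. *)
Lemma cop_winningP K : #|V| * #|V| * L <= K ->
  cop_winning G <-> [exists c0, forall r0, win K 0 c0 r0].
Proof.
move=> le_K; have fixK := win_fix le_K.
split=> [[c0 [s Hs]]|/existsP[c0 /forallP]]; last exact: win_strategy.
apply/existsP; exists c0; apply/forallP => r0; apply/negPn/negP => nwin.
pose esc t c r := odflt r [pick r' | legal_move G t r r' && ~~ win K t.+1 c r'].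
(* The answers of [s] depend on all positions of the robber so far, so the whole list is built
   recursively. *)
pose hist := fix hist t :=
  if t is t'.+1 then rcons (hist t') (esc t' (s (hist t')) (last r0 (hist t')))
  else [:: r0].
pose r t := last r0 (hist t).
have histE t : mkseq r t.+1 = hist t.
  by elim: t => // t IH; rewrite mkseqS IH /r /= last_rcons.
have rS t : r t.+1 = esc t (s (hist t)) (r t) by rewrite /r /= last_rcons.
have rP : robber_play G r.
  move=> t; rewrite rS /esc; case: pickP => [r' /andP[]//|_] /=.
  by rewrite /legal_move eqxx.
have [lc [u catch]] := Hs r rP.
have inv t : ~~ win K t (cop_pos c0 s r t) (r t).
  elim: t => [|t IH]; first exact: nwin.
  move: IH; rewrite fixK => /existsPn/(_ (cop_pos c0 s r t.+1)).
  rewrite /cop_move lc /= negb_or => /andP[_ /forallPn[r']].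
  rewrite negb_imply => Hr'; rewrite rS /esc -histE.
  by case: pickP => [r1 /andP[]//|/(_ r')]; rewrite Hr'.
move: (inv u); rewrite fixK => /existsPn/(_ (cop_pos c0 s r u.+1)).
by rewrite /cop_move lc catch eqxx.
Qed.

End Winning.

(** * Derived expressions *)

Section Derived.

Variable Sigma : finType.
Local Notation expr := (expr Sigma).

Definition eNot (a : expr) : expr := Cond a (Cst _ 0) (Cst _ 1).
Definition eAnd (a b : expr) : expr := Cond a b (Cst _ 0).
Definition eOr (a b : expr) : expr := Cond a (Cst _ 1) b.
(** The value after a round is its index, so the last one is [a - 1]; for [a = 0] the initial 0
    remains. *)
Definition ePred (a : expr) : expr := Rec a a (Cst _ 0) (Var _ 1).
Definition eSub (a b : expr) : expr := Rec b a a (ePred (Var _ 0)).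
Definition eLe (a b : expr) : expr := eNot (eSub a b).
Definition eLt (a b : expr) : expr := eLe (Add a (Cst _ 1)) b.
Definition eEq (a b : expr) : expr := eAnd (eLe a b) (eLe b a).
Definition eMul (a b : expr) : expr := Sum a (Weak 1 b).
(** The double negation turns the number of witnesses into 0 or 1. *)
Definition eEx (n p : expr) : expr := eNot (eNot (Sum n p)).
Definition eAll (n p : expr) : expr := eNot (eEx n (eNot p)).
(* The least [x < n] with [p], or [n]; in [p] the candidate is variable 0, and
   variable 1 is the recursion index, which [p] must ignore. *)
Definition eFind (n p : expr) : expr :=
  Rec n n (Cst _ 0) (Cond p (Var _ 0) (Add (Var _ 0) (Cst _ 1))).
Definition eCall (f a b : expr) : expr := Let b (Let (Weak 1 a) f).

Variables (sz : nat) (A : nat -> nat -> symbol Sigma).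
Local Notation ev := (eval sz A).
Implicit Types (a b n f : expr) (env : seq nat).

Lemma evAdd a b env x y : ev a env = x -> ev b env = y -> ev (Add a b) env = x + y.
Proof. by move=> /= -> ->. Qed.

Lemma evWeak a env k x : ev a (drop k env) = x -> ev (Weak k a) env = x.
Proof. by []. Qed.

Lemma evLet a b env x y : ev a env = x -> ev b (x :: env) = y -> ev (Let a b) env = y.
Proof. by move=> /= ->. Qed.

Lemma evCond a b c env (p : bool) x y : ev a env = p ->
  (p -> ev b env = x) -> (~~ p -> ev c env = y) ->
  ev (Cond a b c) env = if p then x else y.
Proof. by move=> /= ->; case: p => /= [->|_ ->]. Qed.

Lemma evNot a env (p : bool) : ev a env = p -> ev (eNot a) env = ~~ p.
Proof. by move=> /= ->; case: p. Qed.

(** [b] needs a value only if [p] holds; otherwise it may be meaningless, like a residue modulo the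
    length of an empty label. *)
Lemma evAnd a b env (p q : bool) : ev a env = p -> (p -> ev b env = q) ->
  ev (eAnd a b) env = p && q.
Proof. by move=> /= ->; case: p => // ->. Qed.

Lemma evOr a b env (p q : bool) : ev a env = p -> (~~ p -> ev b env = q) ->
  ev (eOr a b) env = p || q.
Proof. by move=> /= ->; case: p => // ->. Qed.

Lemma evPred a env x : ev a env = x -> ev (ePred a) env = x.-1.
Proof. by move=> /= ->; case: x => //= x; rewrite minnE; lia. Qed.

Lemma evSub a b env x y : ev a env = x -> ev b env = y -> ev (eSub a b) env = x - y.
Proof.
move=> Ea Eb; rewrite [LHS]/= -/(ePred _) Ea Eb.
elim: y {Eb} => [|y IH]; first by rewrite subn0.
rewrite [LHS]/= IH; have := @evPred (Var _ 0) [:: x - y, y & env] _ erefl.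
by move=> /= ->; rewrite minnE; lia.
Qed.

Lemma evLe a b env x y : ev a env = x -> ev b env = y -> ev (eLe a b) env = (x <= y).
Proof.
move=> Ea Eb; rewrite /eLe; have := evSub Ea Eb; move: (eSub a b) => c E.
by rewrite [LHS]/= E -subn_eq0; case: eqP.
Qed.

Lemma evLt a b env x y : ev a env = x -> ev b env = y -> ev (eLt a b) env = (x < y).
Proof. by move=> Ea Eb; rewrite -addn1; apply: evLe => //; apply: evAdd. Qed.

Lemma evEq a b env x y : ev a env = x -> ev b env = y -> ev (eEq a b) env = (x == y).
Proof.
by move=> Ea Eb; rewrite eqn_leq; apply: evAnd => [|_]; apply: evLe.
Qed.

Lemma evSum n f env N F : ev n env = N -> (forall i, i < N -> ev f (i :: env) = F i) ->
  ev (Sum n f) env = \sum_(i < N) F i.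
Proof. by move=> /= -> H; apply: eq_bigr => i _; apply: H. Qed.

Lemma evMul a b env x y : ev a env = x -> ev b env = y -> ev (eMul a b) env = x * y.
Proof.
move=> Ea Eb; rewrite (evSum (F := fun=> y) Ea) ?sum_nat_const ?card_ord //.
by move=> i _; apply: evWeak; rewrite /= drop0.
Qed.

Lemma evEx n f env N (p : 'I_N -> bool) : ev n env = N ->
  (forall i : 'I_N, ev f (val i :: env) = p i) -> ev (eEx n f) env = [exists i, p i].
Proof.
move=> /= -> Ef; under eq_bigr do rewrite Ef.
rewrite -[X in if X then _ else _]/(_ == _) sum_nat_eq0.
case: existsP => [[i pi]|no].
  by case: forallP => // /(_ i); rewrite pi.
by case: forallP => //= -[] i; case: (boolP (p i)) => // pi; case: no; exists i.
Qed.

Lemma evAll n f env N (p : 'I_N -> bool) : ev n env = N ->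
  (forall i : 'I_N, ev f (val i :: env) = p i) -> ev (eAll n f) env = [forall i, p i].
Proof.
move=> En Ef; rewrite -[X in nat_of_bool X]negbK negb_forall.
by apply: evNot; apply: evEx => // i; apply: evNot.
Qed.

Lemma evFind n f env N (p : nat -> bool) x : ev n env = N ->
  x <= N -> (forall i, i < x -> ~~ p i) -> (x < N -> p x) ->
  (forall i j, i <= N -> ev f (i :: j :: env) = p i) ->
  ev (eFind n f) env = x.
Proof.
move=> En le_x lt_x px Ef; rewrite [LHS]/= En.
(* The candidate grows by 1 per round until it reaches the least solution and then stays there. *)
suff H k : k <= N -> iteri k
    (fun i y => minn (if ev f [:: y, i & env] == 0 then y + 1 else y) N) 0 = minn k x.
  by rewrite H // minnE; lia.
elim: k => [|k IH] lt_k; first by rewrite min0n.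
rewrite /= IH ?(ltnW lt_k) // Ef; last by rewrite minnE; lia.
case: (ltnP k x) => [lt_kx|le_xk].
  by rewrite (negPf (lt_x _ lt_kx)) /= !minnE; lia.
by rewrite px /= ?minnE; lia.
Qed.

Lemma evCall f a b env x y v : ev a env = x -> ev b env = y ->
  ev f [:: x, y & env] = v -> ev (eCall f a b) env = v.
Proof.
move=> Ea Eb Ef; apply: evLet Eb _; apply: evLet Ef.
by apply: evWeak; rewrite /= drop0.
Qed.

End Derived.

(** * The encoding *)

Definition blocks (bs : seq (seq bool)) : seq letter :=
  flatten [seq rcons (map Some x) None | x <- bs].

Definition off (bs : seq (seq bool)) (k : nat) : nat := size (blocks (take k bs)).

Definition holds (w : seq letter) (a : letter) (q : nat) : bool :=
  (q < size w) && (nth None w q == a).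

(** In a string of blocks this is the index of the block containing position [q]. *)
Definition seps (w : seq letter) (q : nat) : nat := \sum_(i < q) holds w None i.

Lemma seps_count w q : q <= size w -> seps w q = count_mem None (take q w).
Proof.
elim: q => [|q IH] lt_q; first by rewrite /seps big_ord0 take0.
rewrite /seps big_ord_recr /= -/(seps w q) IH ?(ltnW lt_q) //.
by rewrite (take_nth None) // -cats1 count_cat /= addn0 /holds lt_q.
Qed.

Lemma blocks_cat bs bs' : blocks (bs ++ bs') = blocks bs ++ blocks bs'.
Proof. by rewrite /blocks map_cat flatten_cat. Qed.

Lemma count_some (x : seq bool) : count_mem (None : letter) (map Some x) = 0.
Proof. by elim: x. Qed.

Lemma count_blocks bs : count_mem None (blocks bs) = size bs.
Proof.
elim: bs => //= x bs IH.
by rewrite count_cat [count_mem _ (flatten _)]IH -cats1 count_cat count_some.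
Qed.

Lemma blocks_split bs k : k < size bs -> blocks bs =
  blocks (take k bs) ++ map Some (nth [::] bs k) ++ None :: blocks (drop k.+1 bs).
Proof.
move=> lt_k; rewrite -{1}(cat_take_drop k bs) (drop_nth [::] lt_k) blocks_cat.
by rewrite /blocks /= cat_rcons.
Qed.

(** When [j] is the length of the block, the position is that of its separator, which the default
    [None] of [nth] matches. *)
Lemma block_pos bs k j : k < size bs -> j <= size (nth [::] bs k) ->
  [/\ off bs k + j < size (blocks bs),
      nth None (blocks bs) (off bs k + j) = nth None (map Some (nth [::] bs k)) j
    & seps (blocks bs) (off bs k + j) = k].
Proof.
move=> lt_k le_j; have E := blocks_split lt_k.
have lt_q : off bs k + j < size (blocks bs).
  by rewrite E !size_cat /= size_map /off ltn_add2l addnS ltnS (leq_trans le_j) ?leq_addr.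
split=> //.
  rewrite E nth_cat ltnNge leq_addr /= addKn nth_cat size_map.
  case: ltnP => // le_sj; rewrite (_ : j - _ = 0) ?[RHS]nth_default ?size_map //.
  by apply/eqP; rewrite subn_eq0.
rewrite seps_count ?(ltnW lt_q) // E take_cat ltnNge leq_addr /= addKn count_cat.
rewrite count_blocks size_takel ?(ltnW lt_k) // take_cat size_map.
case: ltnP => [lt_j|le_sj]; first by rewrite -map_take count_some addn0.
rewrite (_ : j - _ = 0) ?take0 ?cats0 ?count_some ?addn0 //.
by apply/eqP; rewrite subn_eq0.
Qed.

Lemma offS bs k : k < size bs -> off bs k.+1 = off bs k + (size (nth [::] bs k)).+1.
Proof.
move=> lt_k; rewrite /off (take_nth [::]) // -cats1 blocks_cat size_cat.
by rewrite /blocks /= cats0 size_rcons size_map.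
Qed.

Lemma off_le bs k k' : k <= k' -> off bs k <= off bs k'.
Proof.
move=> le_k; rewrite /off -(@cat_take_drop k _ (take k' bs)) take_takel //.
by rewrite blocks_cat size_cat leq_addr.
Qed.

Lemma pos_block bs q : q < size (blocks bs) ->
  exists k j, [/\ k < size bs, j <= size (nth [::] bs k) & q = off bs k + j].
Proof.
elim: bs q => // x bs IH q; rewrite /= size_cat size_rcons size_map => lt_q.
case: (leqP q (size x)) => [le_q|gt_q].
  by exists 0, q; split; rewrite // /off take0.
have [|k [j [lt_k le_j E]]] := IH (q - (size x).+1); first by rewrite ltn_subLR.
exists k.+1, j; split=> //; rewrite /off /= size_cat size_rcons size_map -/(blocks _).
by rewrite -addnA -/(off bs k) -E subnKC.
Qed.

Lemma blocksP (w : seq letter) : exists bs (x : seq bool), w = blocks bs ++ map Some x.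
Proof.
elim/last_ind: w => [|w a [bs [x ->]]]; first by exists [::], [::].
case: a => [b|].
  by exists bs, (rcons x b); rewrite map_rcons rcons_cat.
exists (rcons bs x), [::]; rewrite cats0 -[rcons bs x]cats1 blocks_cat -cats1 -catA cats1.
by rewrite /blocks /= cats0.
Qed.

Lemma blocks_last (w : seq letter) : holds w None (size w).-1 ->
  exists bs, w = blocks bs.
Proof.
have [bs [x ->]] := blocksP w; case/lastP: x => [|x b]; first by exists bs; rewrite cats0.
rewrite /holds map_rcons -rcons_cat size_rcons /= nth_rcons ltnn eqxx.
by rewrite andbF.
Qed.

(** * Positions in the lower triangle *)

Definition tri (n : nat) : nat := \sum_(i < n) i.

Lemma triS n : tri n.+1 = tri n + n.
Proof. by rewrite /tri big_ord_recr. Qed.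

Lemma tri_le m n : m <= n -> tri m <= tri n.
Proof.
elim: n => [|n IH]; first by rewrite leqn0 => /eqP ->.
by rewrite leq_eqVlt => /orP[/eqP ->//|/IH]; rewrite triS; lia.
Qed.

(** A copy of [pairs n] on natural numbers: the type of [pairs n] depends on [n], which would
    obstruct splitting off the last row. *)
Definition npairs n : seq (nat * nat) :=
  flatten [seq [seq (i, j) | j <- iota 0 i] | i <- iota 0 n].

Lemma npairsS n : npairs n.+1 = npairs n ++ [seq (n, j) | j <- iota 0 n].
Proof. by rewrite /npairs -addn1 iotaD map_cat flatten_cat /= cats0. Qed.

Lemma size_npairs n : size (npairs n) = tri n.
Proof.
elim: n => [|n IH]; first by rewrite /tri big_ord0.
by rewrite npairsS size_cat IH size_map size_iota triS.
Qed.

Lemma nth_npairs x n i j : j < i < n -> nth x (npairs n) (tri i + j) = (i, j).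
Proof.
elim: n => [|n IH] /andP[lt_j]; first by rewrite ltn0.
rewrite ltnS npairsS nth_cat size_npairs leq_eqVlt => /orP[/eqP Ei|lt_i].
  by rewrite -Ei ltnNge leq_addr /= addKn (nth_map 0) ?size_iota // nth_iota.
have := tri_le lt_i; rewrite triS => le_t.
by rewrite (_ : tri i + j < tri n) ?IH ?lt_j //; lia.
Qed.

Lemma pairsE n : [seq (val p.1, val p.2) | p <- pairs n] = npairs n.
Proof.
rewrite /pairs /npairs filter_flatten map_flatten -2!map_comp.
rewrite -val_enum_ord -map_comp; congr flatten; apply: eq_map => i /=.
rewrite filter_map -map_comp.
have -> : iota 0 i = [seq val j | j <- enum 'I_n & val j < i].
  rewrite -(filter_map _ (fun k => k < i)) val_enum_ord.
  by rewrite (filter_iota_ltn 0) // ltnW.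
by rewrite -map_comp.
Qed.

Lemma size_pairs n : size (pairs n) = tri n.
Proof. by rewrite -size_npairs -pairsE size_map. Qed.

Lemma nth_pairs n (x : 'I_n * 'I_n) (i j : 'I_n) : j < i ->
  nth x (pairs n) (tri i + j) = (i, j).
Proof.
move=> lt_ji; have := @nth_npairs (val x.1, val x.2) n i j.
rewrite lt_ji ltn_ord => /(_ isT); rewrite -pairsE (nth_map x); last first.
  by rewrite size_pairs; have := tri_le (ltn_ord i); rewrite triS; lia.
by case: (nth _ _ _) => a b /= [/val_inj -> /val_inj ->].
Qed.

Lemma mem_pairs n (p : 'I_n * 'I_n) : (p \in pairs n) = (p.2 < p.1).
Proof.
rewrite mem_filter andbC; case: p => i j /=.
by rewrite (_ : (i, j) \in _) //; apply/allpairsP; exists (i, j); rewrite !mem_enum.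
Qed.

Lemma encodeE n (G : epgraph 'I_n) :
  encode G = blocks (nseq n true :: [seq entry G p.1 p.2 | p <- pairs n]).
Proof. by rewrite /encode /blocks /= map_nseq. Qed.

Lemma uniq_pairs n : uniq (pairs n).
Proof.
apply: filter_uniq; apply: allpairs_uniq => //; rewrite ?enum_uniq //.
by move=> [i j] [i' j'].
Qed.

(** * From labels back to a graph *)

Section GraphOf.

Variables (n : nat) (es : seq (seq bool)).
Hypotheses (size_es : size es = tri n)
  (es_true : forall x, x \in es -> x != [::] -> true \in x).

Definition label_of (e : {set 'I_n}) : seq bool :=
  if [pick p in pairs n | e == [set p.1; p.2]] is Some p
  then nth [::] es (index p (pairs n)) else [::].

(** A pair of the strict lower triangle is determined by its set, as the larger and the smaller
    element. *)
Lemma label_of_pair p : p \in pairs n ->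
  label_of [set p.1; p.2] = nth [::] es (index p (pairs n)).
Proof.
move=> p_in; rewrite /label_of.
case: pickP => [p' /andP[p'_in /eqP E]|/(_ p)]; last first.
  by rewrite p_in eqxx.
suff -> : p' = p by [].
case: p p' p_in p'_in E => [a b] [c d]; rewrite !mem_pairs /= => ba dc E.
have : c \in [set a; b] by rewrite E !inE eqxx.
have : d \in [set a; b] by rewrite E !inE eqxx orbT.
rewrite !inE => /orP[]/eqP Ed /orP[]/eqP Ec; subst; rewrite ?ltnn // in dc *.
by have := ltn_trans ba dc; rewrite ltnn.
Qed.

Lemma label_of_true e : label_of e != [::] -> true \in label_of e.
Proof.
rewrite /label_of; case: pickP => // p _; case: (ltnP (index p (pairs n)) (size es)).
  by move=> lt_p; apply: es_true; rewrite mem_nth.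
by move=> le_p; rewrite nth_default.
Qed.

Definition graph_of : epgraph 'I_n.
Proof.
refine (@EPGraph _ [set e : {set 'I_n} | (#|e| == 2) && (label_of e != [::])]
          label_of _ _).
- by move=> e; rewrite inE => /andP[/eqP].
- by move=> e; rewrite inE => /andP[_]; apply: label_of_true.
Defined.

Lemma encode_graph_of : encode graph_of = blocks (nseq n true :: es).
Proof.
rewrite encodeE; congr (blocks (_ :: _)); apply: (@eq_from_nth _ [::]).
  by rewrite size_map size_pairs.
move=> k; rewrite size_map => lt_k.
case E: (pairs n) => [|p0 ps]; first by rewrite E in lt_k.
rewrite -E (nth_map p0) //; set p := nth p0 _ _.
have p_in : p \in pairs n by rewrite mem_nth.
rewrite -(index_uniq p0 lt_k (uniq_pairs n)) -/p -label_of_pair // /entry inE.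
have -> : #|[set p.1; p.2]| == 2.
  by move: p_in; rewrite mem_pairs cards2; case: (p.1 =P p.2) => [->|//]; rewrite ltnn.
by case: eqP.
Qed.

End GraphOf.

(** * Recognizing encodings *)

Definition ones (w : seq letter) : nat := find (predC1 (Some true)) w.

(** Describes the encodings by letters alone, so that an expression can test for them. The last
    condition demands a letter 1 in the block of each bit, that is, in each nonempty block. *)
Definition valid (w : seq letter) : bool :=
  [&& holds w None (ones w), holds w None (size w).-1,
      seps w (size w) == (tri (ones w)).+1
    & [forall q : 'I_(size w), holds w None q ||
        [exists q' : 'I_(size w), (seps w q' == seps w q) && holds w (Some true) q']]].

Lemma blocks_cons x bs : blocks (x :: bs) = map Some x ++ None :: blocks bs.
Proof. by rewrite /blocks /= cat_rcons. Qed.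

Lemma ones_blocks n bs : ones (blocks (nseq n true :: bs)) = n.
Proof.
rewrite blocks_cons /ones find_cat map_nseq has_nseq /= andbF.
by rewrite size_nseq addn0.
Qed.

Lemma seps_blocks bs : seps (blocks bs) (size (blocks bs)) = size bs.
Proof. by rewrite seps_count // take_size count_blocks. Qed.

Lemma holdsE bs k j a : k < size bs -> j <= size (nth [::] bs k) ->
  holds (blocks bs) a (off bs k + j) = (nth None (map Some (nth [::] bs k)) j == a).
Proof.
move=> lt_k le_j; have [lt_q E _] := block_pos lt_k le_j.
by rewrite /holds lt_q E.
Qed.

Lemma valid_encode n (G : epgraph 'I_n) : valid (encode G).
Proof.
rewrite encodeE; set es := [seq _ | _ <- _]; set bs := _ :: es.
rewrite /valid ones_blocks seps_blocks /= size_map size_pairs eqxx /=.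
apply/and3P; split.
- rewrite -[X in holds _ _ X](_ : off bs 0 + n = n); last by rewrite /off take0.
  by rewrite holdsE //= ?size_nseq // nth_default // size_map size_nseq.
- have pos : 0 < size bs by [].
  (* The last letter is the separator of the last block. *)
  rewrite (_ : (size _).-1 = off bs (size bs).-1 + size (nth [::] bs (size bs).-1)).
    by rewrite holdsE ?prednK // nth_default ?size_map.
  have := @offS bs (size bs).-1; rewrite prednK // => /(_ (leqnn _)).
  by rewrite addnS {1}/off take_size => ->.
apply/forallP => -[q lt_q] /=; have [k [j [lt_k le_j Eq]]] := pos_block lt_q.
rewrite Eq holdsE //; case: (ltnP j (size (nth [::] bs k))) => lt_j; last first.
  by rewrite nth_default ?size_map.
rewrite (nth_map false) //=.
have [_ _ Es] := block_pos lt_k le_j.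
have true_in : true \in nth [::] bs k.
  have : nth [::] bs k \in bs by rewrite mem_nth.
  rewrite inE => /orP[/eqP E|].
    by rewrite E size_nseq in lt_j *; rewrite mem_nseq eqxx andbT (leq_trans _ lt_j).
  case/mapP => p _ E; rewrite E in lt_j *; move: lt_j; rewrite /entry.
  by case: ifP => // /ep_tau1.
have lt_i : index true (nth [::] bs k) < size (nth [::] bs k) by rewrite index_mem.
have [lt_q' _ Es'] := block_pos lt_k (ltnW lt_i).
apply/existsP; exists (Ordinal lt_q') => /=.
by rewrite Es Es' eqxx holdsE ?(ltnW lt_i) // (nth_map false) // nth_index.
Qed.

Lemma encode_of_valid w : valid w -> exists n (G : epgraph 'I_n), w = encode G.
Proof.
case/and4P=> h1 h2 /eqP h3 /forallP h4; have [bs Ew] := blocks_last h2.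
rewrite Ew in h1 h3 h4 *; rewrite seps_blocks in h3.
case: bs {Ew h2} h1 h3 h4 => [|b es] // h1 [size_es] h4.
set bs := b :: es in h1 size_es h4 *.
(* The first letter other than 1 is a separator, so the first block contains no 0. *)
have b_ones : b = nseq (size b) true.
  apply/all_pred1P/negPn/negP; rewrite -has_predC => hb.
  have hb' : has (predC1 (Some true)) (map Some b).
    by rewrite has_map; apply: sub_has hb => -[].
  move: h1; rewrite /holds /ones blocks_cons find_cat hb'; set i := find _ _.
  have lt_i : i < size b by move: hb'; rewrite has_find size_map.
  by rewrite nth_cat size_map lt_i (nth_map false) // andbF.
have Ebs : blocks bs = blocks (nseq (size b) true :: es) by rewrite /bs {1}b_ones.
have size_es' : size es = tri (size b) by rewrite size_es Ebs ones_blocks.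
exists (size b).
suff es_true x : x \in es -> x != [::] -> true \in x.
  by exists (graph_of (size b) es_true); rewrite encode_graph_of.
(* Block 0 is the vertex count, hence the successor. As [x] is nonempty, its block starts with a
   bit, to which the last condition of [valid] applies. *)
move=> x_in x_neq; set k := (index x es).+1.
have lt_k : k < size bs by rewrite /= ltnS index_mem.
have Ek : nth [::] bs k = x by rewrite /= nth_index.
have [lt_q _ Es] := block_pos lt_k (leq0n (size (nth [::] bs k))).
have /orP[] := h4 (Ordinal lt_q).
  by rewrite /= holdsE // Ek; case: (x) x_neq.
case/existsP => -[q' lt_q'] /andP[/eqP]; rewrite /= Es.
have [k' [j' [lt_k' le_j' ->]]] := pos_block lt_q'.
have [_ _ ->] := block_pos lt_k' le_j' => Ekk.
rewrite holdsE // Ekk Ek => /eqP E.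
case: (ltnP j' (size x)) => [lt_j|le_j]; last by rewrite nth_default ?size_map in E.
by move: E; rewrite (nth_map false) // => -[<-]; rewrite mem_nth.
Qed.

(** * Solving the game *)

Arguments eval : simpl never.

(* The most significant bit comes first. *)
Fixpoint cval (f : nat -> bool) (N : nat) : nat :=
  if N is N'.+1 then (cval f N').*2 + f N' else 0.

(** Subtracting 1 flips a bit iff all less significant bits, those of larger index, are 0. *)
Definition dec_bit (f : nat -> bool) (N j : nat) : bool :=
  if [exists i : 'I_N, (j < i) && f i] then f j else ~~ f j.

Lemma eq_cval f g N : (forall j, j < N -> f j = g j) -> cval f N = cval g N.
Proof.
elim: N => //= N IH E; rewrite E // IH // => j lt_j; apply: E; exact: ltnW.
Qed.

Lemma cval_true N : cval (fun=> true) N = 2 ^ N - 1.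
Proof. by elim: N => //= N ->; rewrite expnS; have := expn_gt0 2 N; lia. Qed.

Lemma cval_eq0 (f : nat -> bool) N : (cval f N == 0) = ~~ [exists i : 'I_N, f i].
Proof.
elim: N => [|N IH] /=; first by apply/esym/existsPn => -[].
rewrite addn_eq0 double_eq0 IH eqb0 -negb_or; congr (~~ _).
apply/idP/existsP => [/orP[/existsP[i fi]|]|[i fi]].
- by exists (widen_ord (leqnSn N) i).
- by move=> fN; exists ord_max.
- rewrite orbC; have := ltn_ord i; rewrite ltnS leq_eqVlt.
  case/orP=> [/eqP Ei|lt_i]; first by rewrite -Ei fi.
  by apply/orP; right; apply/existsP; exists (Ordinal lt_i).
Qed.

Lemma cval_dec (f : nat -> bool) N :
  [exists i : 'I_N, f i] -> (cval (dec_bit f N) N).+1 = cval f N.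
Proof.
elim: N => [|N IH] /=; first by case/existsP => -[].
have E1 : dec_bit f N.+1 N = ~~ f N.
  rewrite /dec_bit ifF //; apply/existsP => -[i /andP[lt_i _]].
  by have := ltn_ord i; rewrite ltnS leqNgt lt_i.
(* Index [N] is the least significant bit: if it is 1, it alone changes; otherwise it becomes 1 and
   the borrow goes to the remaining bits. *)
case: (boolP (f N)) => fN ex; rewrite E1 ?fN ?(negPf fN).
  rewrite (@eq_cval _ f) ?addn0 ?addn1 // => j lt_j.
  by rewrite /dec_bit ifT //; apply/existsP; exists ord_max; rewrite /= lt_j.
rewrite (@eq_cval _ (dec_bit f N)) ?addn0.
  rewrite -IH ?addn1 ?doubleS //; case/existsP: ex => i fi.
  have := ltn_ord i; rewrite ltnS leq_eqVlt => /orP[/eqP Ei|lt_i].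
    by rewrite -Ei fi in fN.
  by apply/existsP; exists (Ordinal lt_i).
move=> j lt_j; rewrite /dec_bit; congr (if _ then _ else _).
apply/existsP/existsP => -[i /andP[lt_i fi]]; last first.
  by exists (widen_ord (leqnSn N) i); rewrite /= lt_i.
have := ltn_ord i; rewrite ltnS leq_eqVlt => /orP[/eqP Ei|lt_iN].
  by rewrite -Ei fi in fN.
by exists (Ordinal lt_iN); rewrite /= lt_i.
Qed.

(** * The game in the expression language *)

Local Notation lexpr := (expr letter).
Local Notation V i := (Var letter i).
Local Notation K k := (Cst letter k).
Local Notation xSize := (Size letter).

Definition xSym (a : letter) (e : lexpr) : lexpr :=
  Read (@Ordinal 3 0 isT) (Some (inl a)) e.
Definition xStored (e : lexpr) : lexpr := Read (@Ordinal 3 1 isT) (mark letter) e.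
Definition xVerts : lexpr := eFind xSize (eNot (xSym (Some true) (V 0))).
Definition xSeps (e : lexpr) : lexpr := Sum e (xSym None (V 0)).
(** Block [k] starts at the first position preceded by [k] separators. [Weak 2] skips the two
    variables bound by [eFind]. *)
Definition xStart (k : lexpr) : lexpr := eFind xSize (eLe (Weak 2 k) (xSeps (V 0))).
Definition xLen (p : lexpr) : lexpr := eFind xSize (xSym None (Add (Weak 2 p) (V 0))).
Definition xTri (e : lexpr) : lexpr := Sum e (V 0).
Definition xBits : lexpr := Add xSize (Add xSize xSize).
Definition xArea : lexpr := eMul xVerts xVerts.
(* The bits of the clock are stored inverted, so that the initial blank tape
   represents the largest value. *)
Definition xClock (j : lexpr) : lexpr := eNot (xStored (Add xArea j)).
(** Horner's scheme from the most significant bit. For [x < l] the number [2 * x + 1] is below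
    [2 * l], so one subtraction reduces it and the cut-off at [l] never takes effect. *)
Definition xMod (l : lexpr) : lexpr :=
  Rec xBits l (K 0)
    (Let (Add (Add (V 0) (V 0)) (xClock (V 1)))
      (Cond (eLe (Weak 3 l) (V 0)) (eSub (V 0) (Weak 3 l)) (V 0))).
Definition xIndex (u v : lexpr) : lexpr :=
  Cond (eLe u v) (Add (xTri v) u) (Add (xTri u) v).
(** Block 0 is the vertex count, hence the shift by 1; an empty label means that there is no
    edge. *)
Definition xLegal : lexpr :=
  eOr (eEq (V 0) (V 1))
    (Let (xStart (Add (xIndex (V 0) (V 1)) (K 1)))
      (Let (xLen (V 0))
        (eAnd (eLt (K 0) (V 0)) (xSym (Some true) (Add (V 1) (xMod (V 0))))))).
(** Variables 0 and 1 are the cop and the robber. In the innermost scope the variables are the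
    robber's reply, the cop's move, and then the two old positions. *)
Definition xWin : lexpr :=
  eEx xVerts (eAnd (eCall xLegal (V 1) (V 0))
    (eOr (eEq (V 0) (V 2))
      (eAll xVerts (eOr (eNot (eCall xLegal (V 3) (V 0)))
                        (xStored (Add (eMul (V 1) xVerts) (V 0))))))).
(** Yields the decremented bit in its inverted, stored form; hence [eNot] for a bit that does not
    change. *)
Definition xTick (j : lexpr) : lexpr :=
  Cond (eEx xBits (eAnd (eLt (Weak 1 j) (V 0)) (xClock (V 0))))
    (eNot (xClock j)) (xClock j).
(** The pair belonging to a cell is found by search rather than by division. *)
Definition xStep : lexpr :=
  Cond (eLt (V 0) xArea)
    (eEx xVerts (eEx xVerts
      (eAnd (eEq (V 2) (Add (eMul (V 1) xVerts) (V 0))) (eCall xWin (V 1) (V 0)))))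
    (Let (eSub (V 0) xArea) (xTick (V 0))).
Definition xValid : lexpr :=
  eAnd (xSym None xVerts) (eAnd (xSym None (ePred xSize))
    (eAnd (eEq (xSeps xSize) (Add (xTri xVerts) (K 1)))
      (eAll xSize (eOr (xSym None (V 0))
        (eEx xSize (eAnd (eEq (xSeps (V 0)) (xSeps (V 1)))
                        (xSym (Some true) (V 0)))))))).
Definition xCells : lexpr := Add xArea xBits.
(** On an invalid input the loop ends at once, and [xResult] rejects. *)
Definition xContinue : lexpr := eAnd xValid (eEx xBits (xClock (V 0))).
Definition xResult : lexpr :=
  eAnd xValid (eEx xVerts (eAll xVerts (eCall xWin (V 1) (V 0)))).

(** * Values of these expressions *)

Section Evaluation.

Variables (w : seq letter) (S : nat -> bool).
Local Notation ev := (eval (size w) (tapes_of w S (fun=> false))).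
Local Notation sz := (size w).
Local Notation n := (ones w).
Implicit Types (e : lexpr) (env : seq nat).

Lemma runSym a e env q : ev e env = q -> ev (xSym a e) env = holds w a q.
Proof.
have -> : ev (xSym a e) env =
  (tapes_of w S (fun=> false) 0 (ev e env) == Some (inl a)) by [].
move=> ->; rewrite /holds /=.
case: (ltnP q sz) => [lt_q|le_q]; first by rewrite (nth_map None).
by rewrite nth_default ?size_map.
Qed.

Lemma runStored e env q : ev e env = q -> ev (xStored e) env = S q.
Proof.
have -> : ev (xStored e) env =
  (tapes_of w S (fun=> false) 1 (ev e env) == mark letter) by [].
by move=> -> /=; case: (S q).
Qed.

Lemma runVerts env : ev xVerts env = n.
Proof.
apply: (@evFind _ _ _ _ _ _ sz (fun q => ~~ holds w (Some true) q)) => //.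
- exact: find_size.
- move=> i lt_i; rewrite negbK /holds (leq_trans lt_i (find_size _ _)) /=.
  by have := before_find None lt_i; rewrite /= => /negbFE.
- move=> lt_n; rewrite /holds lt_n /=; apply: (@nth_find _ None (predC1 (Some true))).
  by rewrite has_find.
- by move=> i j _; apply: evNot; apply: runSym.
Qed.

Lemma runSeps e env q : ev e env = q -> ev (xSeps e) env = seps w q.
Proof.
by move=> E; apply: (evSum (F := fun i => holds w None i)) => // i _; apply: runSym.
Qed.

Lemma runTri e env q : ev e env = q -> ev (xTri e) env = tri q.
Proof. by move=> E; apply: (evSum (F := id)). Qed.

Lemma runBits env : ev xBits env = sz + (sz + sz).
Proof. by []. Qed.

Lemma runArea env : ev xArea env = n * n.
Proof. by apply: evMul; apply: runVerts. Qed.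

Definition clock (j : nat) : bool := ~~ S (n * n + j).
Definition time : nat := cval clock (sz + (sz + sz)).

Lemma runClock e env j : ev e env = j -> ev (xClock e) env = clock j.
Proof.
move=> E; apply: evNot; apply: runStored; apply: evAdd => //; exact: runArea.
Qed.

Lemma runMod e env l : 0 < l -> ev e env = l -> ev (xMod e) env = time %% l.
Proof.
move=> l_gt0 E.
have -> : ev (xMod e) env = iteri (ev xBits env) (fun i x => minn
   (ev (Let (Add (Add (V 0) (V 0)) (xClock (V 1)))
      (Cond (eLe (Weak 3 e) (V 0)) (eSub (V 0) (Weak 3 e)) (V 0))) [:: x, i & env])
    (ev e env)) 0 by [].
rewrite E runBits /time; move: (sz + (sz + sz)) => N.
elim: N => [|N IH]; first by rewrite mod0n.
rewrite [LHS]/= {}IH; set x := cval clock N %% l.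
have lt_x : x < l by rewrite ltn_mod.
have Eh : (cval clock N.+1) %% l = (x + x + clock N) %% l.
  rewrite /= -addnn -modnDml -(modnDml (cval clock N)).
  by rewrite -(modnDmr _ (cval clock N)) modnDml.
rewrite Eh; set h := x + x + clock N.
rewrite (evLet (x := h) (y := if l <= h then h - l else h)).
- rewrite (minn_idPl _); last by rewrite /h; case: (clock N); case: ifP; lia.
  case: leqP => [le_h|lt_h]; last by rewrite modn_small.
  by rewrite -{2}(subnK le_h) modnDr modn_small // /h; case: (clock N) le_h; lia.
- by apply: evAdd; [apply: evAdd | apply: runClock].
- have El : eval sz (tapes_of w S xpred0) (Weak 3 e) [:: h, x, N & env] = l.
    by apply: evWeak; rewrite /= drop0.
  apply: evCond => [|_|_]; [exact: evLe | exact: evSub | by []].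
Qed.

Lemma runValid env : ev xValid env = valid w.
Proof.
apply: evAnd => [|_]; first by apply: runSym; apply: runVerts.
apply: evAnd => [|_]; first by apply: runSym; apply: evPred.
apply: evAnd => [|_].
  apply: evEq; first exact: runSeps.
  by rewrite -[RHS]addn1; apply: evAdd => //; apply: runTri; apply: runVerts.
apply: evAll => // q; apply: evOr => [|_]; first exact: runSym.
apply: evEx => // q'; apply: evAnd => [|_]; last exact: runSym.
by apply: evEq; apply: runSeps.
Qed.

Section Encoded.

Variables (m : nat) (G : epgraph 'I_m).
Hypothesis Ew : w = encode G.

Let bs := nseq m true :: [seq entry G p.1 p.2 | p <- pairs m].

Let Eb : w = blocks bs.
Proof. by rewrite Ew encodeE. Qed.

Let Em : n = m.
Proof. by rewrite Eb ones_blocks. Qed.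

Lemma runVerts_encode env : ev xVerts env = m.
Proof. by rewrite runVerts Em. Qed.

Lemma runStart e env k : k < size bs -> ev e env = k -> ev (xStart e) env = off bs k.
Proof.
move=> lt_k E.
have [lt_off _ seps_off] := block_pos lt_k (leq0n _).
rewrite -Eb addn0 in lt_off seps_off.
apply: (@evFind _ _ _ _ _ _ sz (fun x => k <= seps w x)) => //.
- exact: ltnW.
- move=> i lt_i; have lt_iw := ltn_trans lt_i lt_off.
  rewrite Eb in lt_iw; have [k' [j [lt_k' le_j Ei]]] := pos_block lt_iw.
  have [_ _ Es] := block_pos lt_k' le_j; rewrite Eb Ei Es -ltnNge.
  rewrite ltnNge; apply/negP => /(off_le bs) le_off.
  by move: lt_i; rewrite Ei ltnNge (leq_trans le_off) ?leq_addr.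
- by rewrite seps_off.
move=> i j _; apply: evLe; last exact: runSeps.
by apply: evWeak; rewrite /= drop0.
Qed.

Lemma runLen e env k : k < size bs -> ev e env = off bs k ->
  ev (xLen e) env = size (nth [::] bs k).
Proof.
move=> lt_k E; have [lt_off _ _] := block_pos lt_k (leqnn _); rewrite -Eb in lt_off.
apply: (@evFind _ _ _ _ _ _ sz (fun x => holds w None (off bs k + x))) => //.
- by rewrite (leq_trans (leq_addl _ _) (ltnW lt_off)).
- by move=> i lt_i; rewrite Eb holdsE ?(ltnW lt_i) // (nth_map false).
- by rewrite Eb holdsE // [nth None _ _]nth_default ?size_map.
move=> i j _; apply: runSym; apply: evAdd => //.
by apply: evWeak; rewrite /= drop0.
Qed.

Lemma runIndex a b env (u v : 'I_m) : u != v -> ev a env = u -> ev b env = v ->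
  exists k, [/\ ev (xIndex a b) env = k, k.+1 < size bs &
    nth [::] bs k.+1 = entry G u v].
Proof.
have main (i j : 'I_m) : j < i -> (tri i + j).+1 < size bs /\
    nth [::] bs (tri i + j).+1 = entry G i j.
  move=> lt_ji; have lt_t : tri i + j < size (pairs m).
    by rewrite size_pairs; have := tri_le (ltn_ord i); rewrite triS; lia.
  by rewrite /= ltnS size_map lt_t (nth_map (i, i)) // nth_pairs.
move=> nuv Ea Eb'.
exists (if u <= v then tri v + u else tri u + v).
have -> : ev (xIndex a b) env = if u <= v then tri v + u else tri u + v.
  apply: evCond => [|_|_]; first exact: evLe;
  by apply: evAdd => //; apply: runTri.
move: nuv; rewrite neq_ltn => /orP[lt_uv|lt_vu].
  rewrite (ltnW lt_uv); have [-> ->] := main v u lt_uv; split=> //.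
  by rewrite /entry (setUC [set v]).
by rewrite leqNgt lt_vu; have [-> ->] := main u v lt_vu.
Qed.

Lemma runLegal env (u v : 'I_m) :
  ev xLegal [:: val u, val v & env] = legal_move G time u v.
Proof.
apply: evOr => [|nuv]; first by rewrite -val_eqE; apply: evEq.
have [k [Ek lt_k nth_k]] :=
  @runIndex (V 0) (V 1) [:: val u, val v & env] u v nuv erefl erefl.
apply: evLet.
  by apply: (@runStart _ _ k.+1) => //; rewrite -[RHS]addn1; apply: evAdd.
apply: evLet; first by apply: (@runLen _ _ k.+1).
rewrite nth_k /present /entry; case: ifP => e_in.
  have tau_gt0 : 0 < size (ep_tau G [set u; v]).
    by have := ep_tau1 e_in; case: (ep_tau G _).
  set tau := ep_tau G [set u; v] in tau_gt0 *.
  rewrite -[RHS]/(nat_of_bool (true && _)).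
  apply: evAnd => [|_]; first by rewrite (evLt (x := 0) (y := size tau)) // tau_gt0.
  have lt_t : time %% size tau < size tau by rewrite ltn_mod.
  have Enth : nth [::] bs k.+1 = tau by rewrite nth_k /entry e_in.
  rewrite (@runSym _ _ _ (off bs k.+1 + time %% size tau)); last first.
    by apply: evAdd => //; apply: runMod.
  rewrite Eb holdsE ?Enth ?(ltnW lt_t) // (nth_map false) //.
  by case: (nth _ _ _).
by rewrite -[RHS]/(nat_of_bool (false && false)); apply: evAnd.
Qed.

Variable X : 'I_m -> 'I_m -> bool.
Hypothesis SX : forall c r : 'I_m, S (c * m + r) = X c r.

Lemma runWin env (c r : 'I_m) :
  ev xWin [:: val c, val r & env] = win_step G time X c r.
Proof.
apply: evEx => [|c']; first exact: runVerts_encode.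
apply: evAnd => [|_]; first by apply: evCall => //; apply: runLegal.
apply: evOr => [|_]; first by rewrite -val_eqE; apply: evEq.
apply: evAll => [|r']; first exact: runVerts_encode.
rewrite implybE; apply: evOr => [|_].
  by apply: evNot; apply: evCall => //; apply: runLegal.
rewrite -SX; apply: runStored; apply: evAdd => //.
by apply: evMul => //; apply: runVerts_encode.
Qed.

Lemma runStep_win env (c r : 'I_m) :
  ev xStep (c * m + r :: env) = win_step G time X c r.
Proof.
have lt_q : c * m + r < n * n.
  by rewrite Em; have := ltn_ord c; have := ltn_ord r; nia.
rewrite (evCond (p := true) (x := win_step G time X c r) (y := 0)) //.
  by rewrite (evLt (x := c * m + r) (y := n * n)) ?lt_q //; apply: runArea.
(* The number [c * m + r] determines [c] and [r], so the search finds only this pair. *)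
move=> _; have -> : win_step G time X c r = [exists c' : 'I_m, exists r' : 'I_m,
    (c * m + r == c' * m + r') && win_step G time X c' r'].
  apply/idP/existsP => [H|[c' /existsP[r' /andP[/eqP E]]]].
    by exists c; apply/existsP; exists r; rewrite eqxx.
  have m_gt0 : 0 < m by apply: leq_ltn_trans (ltn_ord c).
  have -> : c' = c.
    apply/val_inj; have := congr1 (divn^~ m) E.
    by rewrite /= !divnMDl // !divn_small // !addn0.
  have -> // : r' = r.
    apply/val_inj; have := congr1 (modn^~ m) E.
    by rewrite /= !modnMDl !modn_small.
apply: evEx => [|c']; first exact: runVerts_encode.
apply: evEx => [|r']; first exact: runVerts_encode.
apply: evAnd => [|_]; last by apply: evCall => //; apply: runWin.
apply: evEq => //; apply: evAdd => //.
by apply: evMul => //; apply: runVerts_encode.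
Qed.

Lemma runStep_clock env j :
  ev xStep (n * n + j :: env) = ~~ dec_bit clock (sz + (sz + sz)) j.
Proof.
rewrite (evCond (p := false) (x := 0) (y := ~~ dec_bit clock (sz + (sz + sz)) j)) //.
  rewrite (evLt (x := n * n + j) (y := n * n)) ?ltnNge ?leq_addr //.
  exact: runArea.
move=> _; apply: (evLet (x := j)).
  by rewrite -[RHS](addKn (n * n)); apply: evSub => //; apply: runArea.
rewrite /dec_bit [RHS](_ : _ = if [exists i : 'I_(sz + (sz + sz)), (j < i) && clock i]
   then ~~ clock j : nat else clock j : nat); last first.
  by case: ifP => _ //; rewrite negbK.
apply: evCond => [|_|_].
- apply: evEx => // i; apply: evAnd => [|_]; last exact: runClock.
  exact: evLt.
- by apply: evNot; apply: runClock.
- exact: runClock.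
Qed.

Lemma runResult env :
  ev xResult env = [exists c, forall r, win_step G time X c r].
Proof.
rewrite -[RHS]/(nat_of_bool (true && _)).
apply: evAnd => [|_]; first by rewrite runValid Ew valid_encode.
apply: evEx => [|c]; first exact: runVerts_encode.
apply: evAll => [|r]; first exact: runVerts_encode.
by apply: evCall => //; apply: runWin.
Qed.

Lemma runContinue env : ev xContinue env = (time != 0).
Proof.
rewrite /time cval_eq0 negbK -[RHS]/(nat_of_bool (true && _)).
apply: evAnd => [|_]; first by rewrite runValid Ew valid_encode.
by apply: evEx => // i; apply: runClock.
Qed.

End Encoded.

End Evaluation.

(** * The horizon and the main loop *)

Lemma prod_size_le (es : seq (seq bool)) :
  \prod_(x <- es) (size x).-1.+1 <= 2 ^ size (blocks es).
Proof.
elim: es => [|x es IH]; first by rewrite big_nil.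
rewrite big_cons blocks_cons size_cat size_map expnD leq_mul //.
  by case: (size x) => // k; apply: ltnW; apply: ltn_expl.
by rewrite (leq_trans IH) // leq_exp2l //= leqnSn.
Qed.

Lemma cop_winning_encode m (G : epgraph 'I_m) (sz := size (encode G)) :
  cop_winning G <-> [exists c, forall r, win G (2 ^ (sz + (sz + sz))) 0 c r].
Proof.
pose es := [seq entry G p.1 p.2 | p <- pairs m].
(* The factor [(size x).-1.+1] is 1 for the empty label of a non-edge, so the product stays
   positive. *)
pose L := \prod_(x <- es) (size x).-1.+1.
have L_gt0 : 0 < L by rewrite prodn_gt0.
have size_w : sz = m.+1 + size (blocks es).
  by rewrite /sz encodeE blocks_cons size_cat size_map size_nseq /= addnS.
apply: (cop_winningP (L := L)) => //.
  move=> e e_in; have /eqP/cards2P[i [j [ij E]]] := ep_edges2 e_in.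
  wlog lt_ji : i j ij E / j < i => [wl|].
    case: (ltngtP j i) => [|lt_ij|/val_inj Eij]; first exact: (wl i j).
      by apply: (wl j i) => //; rewrite 1?eq_sym // setUC.
    by rewrite Eij eqxx in ij.
  have tau_in : ep_tau G e \in es.
    apply/mapP; exists (i, j); first by rewrite mem_pairs.
    by rewrite /entry -E e_in.
  rewrite /L (big_rem _ tau_in) /= prednK ?dvdn_mulr //.
  by have := ep_tau1 e_in; case: (ep_tau G e).
(* One factor [2 ^ sz] for each of the two positions and one for [L]. *)
rewrite card_ord -mulnA.
have le_m : m <= 2 ^ sz.
  by apply: leq_trans (ltnW (ltn_expl sz _)) => //; rewrite size_w; lia.
rewrite expnD leq_mul // expnD leq_mul //.
by rewrite (leq_trans (prod_size_le es)) // leq_exp2l // size_w leq_addl.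
Qed.

(** The clock already shows the step that the next round computes, so it reaches 0 while the stored
    region is still that of time 1. *)
Lemma iter_state w m (G : epgraph 'I_m) : w = encode G ->
  let N := size w + (size w + size w) in
  let St k := iter k (next xCells xStep w) (fun=> false) in
  forall k, k < 2 ^ N ->
  time w (St k) = 2 ^ N - k.+1 /\
  forall c r : 'I_m, St k (c * m + r) = win G k (2 ^ N - k) c r.
Proof.
move=> Ew N St; have Em : ones w = m by rewrite Ew encodeE ones_blocks.
elim=> [|k IH] lt_k.
  (* On the blank tape every clock bit is 1 and the region is empty, as for [win 0]. *)
  by split=> //=; rewrite /time /clock cval_true.
have [Et EX] := IH (ltnW lt_k).
have ECells S : run xCells w S [::] = m * m + N.
  by rewrite -{1 2}Em; apply: evAdd; [apply: runArea | apply: runBits].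
have next_step q : q < m * m + N -> St k.+1 q = (run xStep w (St k) [:: q] != 0).
  by move=> lt_q; rewrite /St iterS -/(St k) /next ECells lt_q.
split.
  rewrite /time (@eq_cval _ (dec_bit (clock w (St k)) N)); last first.
    move=> j lt_j; rewrite [LHS]/clock Em next_step ?ltn_add2l //.
    have := runStep_clock w (St k) [::] j; rewrite Em /run => ->.
    by case: (dec_bit _ _ _).
  apply: succn_inj; rewrite cval_dec; last first.
    by rewrite -[[exists i, _]]negbK -cval_eq0 -/(time w (St k)) Et; lia.
  by rewrite -/(time w (St k)) Et; lia.
move=> c r; rewrite next_step; last first.
  by have := ltn_ord c; have := ltn_ord r; nia.
rewrite /run (runStep_win Ew EX) Et.
rewrite (_ : 2 ^ N - k = (2 ^ N - k.+1).+1); last by lia.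
by rewrite [win G k.+1 _ c r]/=; case: (win_step _ _ _ _ _).
Qed.

Theorem theorem4 : PSPACE cops_and_robber.
Proof.
apply: (@iteration_PSPACE letter xCells xStep xContinue xResult) => // w.
case: (boolP (valid w)) => [w_valid|w_invalid]; last first.
  have run0 e S : run (eAnd xValid e) w S [::] = 0.
    rewrite -[RHS]/(nat_of_bool (false && false)); apply: evAnd => //.
    by rewrite runValid (negPf w_invalid).
  exists 0; split=> //; first exact: run0.
  rewrite run0; split=> // -[m [G [Ew _]]].
  by rewrite Ew valid_encode in w_invalid.
pose N := size w + (size w + size w); exists (2 ^ N - 1).
have pos : 0 < 2 ^ N by rewrite expn_gt0.
(* Stated for every graph with encoding [w]: the hypothesis [cops_and_robber w] brings its own
   graph, which may differ from the decoded one. *)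
have run_graph m (G : epgraph 'I_m) : w = encode G ->
    let St k := iter k (next xCells xStep w) (fun=> false) in
    [/\ forall k, k < 2 ^ N -> run xContinue w (St k) [::] = (2 ^ N - k.+1 != 0) &
        run xResult w (St (2 ^ N - 1)) [::] != 0 <-> cop_winning G].
  move=> Ew St; split.
    move=> k /(iter_state Ew) [Et _].
    by rewrite /run (runContinue _ Ew) Et.
  have [|Et EX] := iter_state Ew (k := 2 ^ N - 1); first by rewrite -/N; lia.
  rewrite /run (runResult Ew EX) Et -/N.
  rewrite (_ : 2 ^ N - (2 ^ N - 1) = 1); last by lia.
  rewrite (_ : 2 ^ N - (2 ^ N - 1).+1 = 0); last by lia.
  rewrite (cop_winning_encode G) -Ew -/N.
  (* The loop has stopped with the region of time 1; [xResult] carries out the step at time 0. *)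
  have -> : [exists c, forall r, win_step G 0 (win G (2 ^ N - 1) 1) c r] =
            [exists c, forall r, win G (2 ^ N) 0 c r].
    by rewrite -{2}(subnK pos) addn1.
  by rewrite eqb0 negbK.
have [m [G Ew]] := encode_of_valid w_valid.
have [HC HR] := run_graph m G Ew.
split.
- by move=> k lt_k; rewrite HC; lia.
- by rewrite HC; lia.
split.
  by move/HR => win_G; exists m, G.
by case=> m' [G' [Ew' /(proj2 (proj2 (run_graph m' G' Ew')))]].
Qed.
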